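(* Let $d\ge1$, $n\ge\max\{2,d\}$, and let $\xi_1,\dots,\xi_n$ be random vectors in $\mathbb{R}^d$ such that $(\xi_1,\dots,\xi_n)\stackrel{d}{=}(\varepsilon_1\xi_{\sigma(1)},\dots,\varepsilon_n\xi_{\sigma(n)})$ for every permutation $\sigma$ of $\{1,\dots,n\}$ and every $\varepsilon_1,\dots,\varepsilon_n\in\{-1,1\}$ with $\varepsilon_1\cdots\varepsilon_n=1$. Let $S_k=\xi_1+\dots+\xi_k$, $1\le k\le n$, and $S_n^*=S_{n-1}-\xi_n$. Assume that any $d$ random vectors from either collection $S_1,\dots,S_n$ or $S_1,\dots,S_{n-1},S_n^*$ are linearly independent a.s. Then $$\mathbb{P}[0\in\mathrm{Conv}(S_1,\dots,S_{n-1},S_n,S_n^* )]=\frac{2}{2^{n-1}n!}\big(D(n,d+1)+D(n,d+3)+\dots\big),$$ where $D(n,k)$ are defined by $(t+1)(t+3)\cdots(t+2n-3)(t+n-1)=\sum_{k=0}^nD(n,k)t^k$, with $D(n,k)=0$ for $k\notin\{0,\dots,n\}$.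
   Context: $\mathrm{Conv}$ denotes the convex hull. *)

(* Defs.v *)
From HB Require Import structures.
From mathcomp Require Import all_boot all_order all_fingroup all_algebra.
From mathcomp Require Import all_classical all_reals all_analysis.
Set Implicit Arguments. Unset Strict Implicit. Unset Printing Implicit Defensive.
Import Order.TTheory GRing.Theory Num.Theory.
Import numFieldNormedType.Exports.
Local Open Scope classical_set_scope.
Local Open Scope ring_scope.

Definition borel_mx (R : realType) (m n : nat) : set (set 'M[R]_(m, n)) :=
  <<s [set U | open U] >>.

Definition random_vector {dT : measure_display} {T : measurableType dT}
  (R : realType) (d : nat) (X : T -> 'rV[R]_d) : Prop :=
  forall A, borel_mx A -> measurable (X @^-1` A).

Definition eq_in_law {dT : measure_display} {T : measurableType dT}
  (R : realType) (P : probability T R) (m n : nat)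
  (X Y : T -> 'M[R]_(m, n)) : Prop :=
  forall A, borel_mx A -> P (X @^-1` A) = P (Y @^-1` A).

Definition conv_hull (R : realType) (d : nat) (I : finType)
  (p : I -> 'rV[R]_d) : set 'rV[R]_d :=
  [set x | exists w : I -> R, (forall i, 0 <= w i) /\ \sum_i w i = 1
                             /\ \sum_i w i *: p i = x].

Definition lin_indep (R : realType) (d : nat) (v : 'I_d -> 'rV[R]_d) : Prop :=
  row_free (\matrix_(j < d) v j).

(* Partial sums S_{k+1} = xi_1 + ... + xi_{k+1} for k : 'I_n (0-based). *)
Definition Ssum (R : realType) (d n : nat) (xi : 'I_n -> 'rV[R]_d) (k : 'I_n)
  : 'rV[R]_d := \sum_(i < n | (i <= k)%N) xi i.

Definition Sstar (R : realType) (d n : nat) (xi : 'I_n -> 'rV[R]_d) : 'rV[R]_d :=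
  \sum_(i < n) (if (i : nat) == n.-1 then - xi i else xi i).

Definition Ssum' (R : realType) (d n : nat) (xi : 'I_n -> 'rV[R]_d) (k : 'I_n)
  : 'rV[R]_d := if (k : nat) == n.-1 then Sstar xi else Ssum xi k.

Definition Spts (R : realType) (d n : nat) (xi : 'I_n -> 'rV[R]_d)
  (k : option 'I_n) : 'rV[R]_d :=
  match k with Some k => Ssum xi k | None => Sstar xi end.

Definition Dpoly (n : nat) : {poly int} :=
  (\prod_(i < n.-1) ('X + (2 * i + 1)%:R%:P)) * ('X + (n.-1)%:R%:P).

(* D(n,k) = coefficient of t^k; zero for k > n automatically. *)
Definition D (n k : nat) : int := (Dpoly n)`_k.

(* Main.v *)
(** By Abel summation, [0] lies in the hull iff the subspace
    [L = {x | sum_i x_i xi_i = 0}] of codimension [d] meets the closed chamber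
    [x_1 >= ... >= x_{n-1} >= |x_n|] of type [D_n] outside [0].  This chamber is
    the union of two chambers of type [B_n], exchanged by flipping the sign of
    the last step and meeting in a chamber of type [B_{n-1}], so inclusion and
    exclusion reduces everything to counting chambers of type [B] met by a
    subspace in general position; correspondingly [D_n = B_n - n B_{n-1}], where
    [B_n(t) = (t+1)(t+3)...(t+2n-1)].  For type [B], the cylinder [C x R] over a
    chamber [C] of [B_{n-1}] is cut into chambers of [B_n] by the [2n-1] disjoint
    slices [x_n = 0] and [x_n = +-x_j].  As [L] is convex, it meets one more
    chamber in the cylinder than slices; projecting [L] lowers the codimension
    by one, while intersecting it with a slice keeps it.  This is the recursion
    of the coefficients of [B_n(t) = (t+2n-1) B_{n-1}(t)].  Averaging the count
    over the symmetry group gives the probability. *)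

Require Import Defs.
From HB Require Import structures.
From mathcomp Require Import all_boot all_order all_fingroup all_algebra.
From mathcomp Require Import all_classical all_reals all_analysis.
From mathcomp Require Import measurable_realfun zify ring lra.
Set Implicit Arguments. Unset Strict Implicit. Unset Printing Implicit Defensive.
Import Order.TTheory GRing.Theory Num.Theory.
Import numFieldNormedType.Exports.
Local Open Scope ring_scope.

(** * Chambers of type B met by a subspace *)

Section SignedOrders.
Variables (R : realFieldType) (d : nat).
Implicit Types (x : nat -> R) (l : seq (nat * bool)) (a : nat -> 'rV[R]_d).

Definition signed_val x (e : nat * bool) : R := (-1) ^+ e.2 * x e.1.

(* Beyond the length of [l] the value is [0], so that a nonincreasing [chain]
   is automatically nonnegative. *)
Definition chain x l (k : nat) : R := nth 0 (map (signed_val x) l) k.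

Definition insert l (p : nat) e := take p l ++ e :: drop p l.

(** The [n.+1] positions and two signs of the new index correspond to the [2 * n.+1] chambers into
    which the cylinder over a chamber on [n] coordinates is cut. *)
Definition slots n : seq (nat * bool) :=
  [seq (p, b) | p <- iota 0 n.+1, b <- [:: false; true]].

(* [l] stands for the chamber [s_1 x_{i_1} >= ... >= s_n x_{i_n} >= 0], where
   [(i_k, s_k)] is the [k]-th entry of [l] and [true] encodes the sign [-1]. *)
Fixpoint signed_orders n : seq (seq (nat * bool)) :=
  if n is m.+1 then
    [seq insert l z.1 (m, z.2) | l <- signed_orders m, z <- slots m]
  else [:: [::]].

Lemma signed_ordersS n : signed_orders n.+1 =
  [seq insert l z.1 (n, z.2) | l <- signed_orders n, z <- slots n].
Proof. by []. Qed.

Definition comb n x a : 'rV[R]_d := \sum_(i < n) x i *: a i.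

(* In a closed chamber, a positive first value singles out the nonzero points.
   The subspace is given as [{x | sum_i x_i a_i \in W}], which is stable under
   the projection along the last coordinate: it adds [a_n] to [W]. *)
Definition chamber n a (W : 'M[R]_d) l x : Prop :=
  [/\ (comb n x a <= W)%MS,
    forall k, chain x l k.+1 <= chain x l k & 0 < chain x l 0].

Definition hit n a W l : Prop := exists x, chamber n a W l x.

Definition hits n a W : nat := \sum_(l <- signed_orders n) `[< hit n a W l >].

(* The flats of dimension at most [c] of the arrangement consist of the [x]
   whose nonzero [|x_i|] take at most [c] values. *)
Definition generic n a (W : 'M[R]_d) (c : nat) : Prop :=
  forall x (s : seq R), (size s <= c)%N -> (comb n x a <= W)%MS ->
    (forall i, (i < n)%N -> x i != 0 -> `|x i| \in s) ->
    forall i, (i < n)%N -> x i = 0.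

Lemma perm_signed_orders n l :
  l \in signed_orders n -> perm_eq (map fst l) (iota 0 n).
Proof.
elim: n l => [|n IHn] l; first by rewrite inE => /eqP ->.
rewrite -[in iota _ _]addn1 iotaD.
case/allpairsP => -[l0 [p b]] [/IHn hl0 _ ->].
rewrite /insert map_cat map_cons -cat1s perm_catCA.
by rewrite -map_cat cat_take_drop perm_sym perm_catC perm_cat2l perm_sym.
Qed.

Lemma size_signed_order n l : l \in signed_orders n -> size l = n.
Proof.
by move=> /perm_signed_orders /perm_size; rewrite size_map size_iota.
Qed.

Lemma slots_big n (F : nat -> bool -> nat) :
  (\sum_(z <- slots n) F z.1 z.2 =
   \sum_(0 <= p < n.+1) F p false + \sum_(0 <= p < n.+1) F p true)%N.
Proof.
rewrite /slots big_allpairs_dep -big_split /index_iota subn0 /=.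
by apply: eq_bigr => p _; rewrite big_cons big_seq1.
Qed.

Lemma signed_orders_bigS n (F : seq (nat * bool) -> nat) :
  (\sum_(l <- signed_orders n.+1) F l = \sum_(l <- signed_orders n)
     (\sum_(0 <= p < n.+1) F (insert l p (n, false)) +
      \sum_(0 <= p < n.+1) F (insert l p (n, true))))%N.
Proof.
etransitivity; first exact: big_allpairs_dep.
apply: eq_bigr => l _.
by rewrite (slots_big _ (fun p b => F (insert l p (n, b)))).
Qed.

Definition parity l : bool := odd (count snd l).

Lemma parity_insert l p e : parity (insert l p e) = e.2 (+) parity l.
Proof.
rewrite /parity /insert count_cat /= addnCA oddD oddb -count_cat.
by rewrite cat_take_drop.
Qed.

(** Changing the sign of the index inserted last exchanges the parities, so each takes half of the
    signed orders. *)
Lemma count_parity n b :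
  count (fun l => parity l == b) (signed_orders n.+1) = (2 ^ n * n.+1`!)%N.
Proof.
have sz m : size (signed_orders m) = (2 ^ m * m`!)%N.
  elim: m => // m IHm.
  rewrite [LHS](size_allpairs (fun l z => insert l z.1 (m, z.2))) IHm.
  by rewrite /slots size_allpairs size_iota factS expnS /=; lia.
rewrite -sum1_count big_mkcond signed_orders_bigS.
rewrite (eq_bigr (fun=> n.+1)).
  by rewrite big_const_seq count_predT iter_addn_0 sz factS; lia.
move=> l _; rewrite -big_split /= (eq_bigr (fun=> 1%N)).
  by rewrite sum_nat_const_nat; lia.
by move=> p _; rewrite !parity_insert; case: (parity l); case: b.
Qed.

Lemma size_signed_orders n : size (signed_orders n) = (2 ^ n * n`!)%N.
Proof.
case: n => // n; rewrite -(count_predC (fun l => parity l == true)).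
rewrite count_parity (eq_count (a2 := fun l => parity l == false)).
  by rewrite count_parity expnS; lia.
by move=> l /=; case: (parity l).
Qed.

Lemma chain_insert x l p e k : (p <= size l)%N ->
  chain x (insert l p e) k =
    if (k < p)%N then chain x l k
    else if k == p then signed_val x e else chain x l k.-1.
Proof.
move=> hp; rewrite /chain /insert map_cat /= map_take map_drop.
rewrite nth_cat size_takel ?size_map //.
case: ltngtP => [kp|pk|->]; first by rewrite nth_take.
  have -> : (k - p = (k.-1 - p).+1)%N by lia.
  by rewrite /= nth_drop; congr (nth _ _ _); lia.
by rewrite subnn.
Qed.

Lemma chain_default x l k : (size l <= k)%N -> chain x l k = 0.
Proof. by move=> h; rewrite /chain nth_default // size_map. Qed.

Lemma chain_homo x l : (forall k, chain x l k.+1 <= chain x l k) ->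
  forall i j, (i <= j)%N -> chain x l j <= chain x l i.
Proof.
move=> h i j /subnK <-; elim: (j - i)%N => [|m IHm]; first by rewrite add0n.
by rewrite addSn (le_trans (h _)).
Qed.

Lemma chain_ge0 x l : (forall k, chain x l k.+1 <= chain x l k) ->
  forall k, 0 <= chain x l k.
Proof.
move=> h k; rewrite -(@chain_default x l (maxn k (size l))) ?leq_maxr //.
by apply: chain_homo => //; rewrite leq_maxl.
Qed.

Lemma chain_lin x y l (s t : R) k :
  chain (fun i => s * x i + t * y i) l k = s * chain x l k + t * chain y l k.
Proof.
have [h|h] := ltnP k (size l); last by rewrite !chain_default // !mulr0 addr0.
rewrite /chain !(nth_map (0%N, false)) // /signed_val; ring.
Qed.

Lemma comb_lin n x y a (s t : R) :
  comb n (fun i => s * x i + t * y i) a = s *: comb n x a + t *: comb n y a.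
Proof.
rewrite /comb !scaler_sumr -big_split; apply: eq_bigr => i _ /=.
by rewrite scalerDl !scalerA.
Qed.

(** * Convex cones cut by a hyperplane, and the slices of a cylinder *)

Definition convex_cone (K : (nat -> R) -> Prop) :=
  forall x y s t, K x -> K y -> 0 < s -> 0 < t ->
    K (fun i => s * x i + t * y i).

Definition linear_form (f : (nat -> R) -> R) :=
  forall x y s t, f (fun i => s * x i + t * y i) = s * f x + t * f y.

Definition nonvoid (K : (nat -> R) -> Prop) : nat := `[< exists x, K x >].

Lemma eq_nonvoid (K K' : (nat -> R) -> Prop) : (forall x, K x <-> K' x) ->
  nonvoid K = nonvoid K'.
Proof.
by move=> h; congr nat_of_bool; apply/asboolP/asboolP => -[x /h hx]; exists x.
Qed.

(* [K] convex: a segment from [0 <= f] to [f <= 0] crosses [f = 0]. *)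
Lemma nonvoid_split (K K1 K2 K0 : (nat -> R) -> Prop) f :
  convex_cone K -> linear_form f ->
  (forall x, K1 x <-> K x /\ 0 <= f x) ->
  (forall x, K2 x <-> K x /\ f x <= 0) ->
  (forall x, K0 x <-> K x /\ f x = 0) ->
  (nonvoid K1 + nonvoid K2 = nonvoid K + nonvoid K0)%N.
Proof.
move=> Kc fl h1 h2 h0; rewrite /nonvoid.
case: asboolP => [[x /h1[Kx fx]]|n1]; case: asboolP => [[y /h2[Ky fy]]|n2].
- rewrite asboolT; last by exists x.
  rewrite asboolT //.
  move: fx fy; rewrite le_eqVlt => /orP[/eqP fx _|fx].
    by exists x; apply/h0.
  rewrite le_eqVlt => /orP[/eqP fy|fy]; first by exists y; apply/h0.
  exists (fun i => - f y * x i + f x * y i); apply/h0; split.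
    by apply: Kc; rewrite ?oppr_gt0.
  by rewrite fl; ring.
- rewrite asboolT ?asboolF //; last by exists x.
  by move=> [z /h0[Kz fz]]; apply: n2; exists z; apply/h2; rewrite fz.
- rewrite asboolT ?asboolF //; last by exists y.
  by move=> [z /h0[Kz fz]]; apply: n1; exists z; apply/h1; rewrite fz.
- rewrite !asboolF //.
    by move=> [z /h0[Kz fz]]; apply: n1; exists z; apply/h1; rewrite fz.
  move=> [z Kz]; have [fz|/ltW fz] := leP 0 (f z).
    by apply: n1; exists z; apply/h1.
  by apply: n2; exists z; apply/h2.
Qed.

Lemma chain_null n l x : l \in signed_orders n ->
  (forall k, chain x l k.+1 <= chain x l k) -> chain x l 0 <= 0 ->
  forall i, (i < n)%N -> x i = 0.
Proof.
move=> hl hx h0 i lt_in.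
have : i \in map fst l by rewrite (perm_mem (perm_signed_orders hl)) mem_iota.
case/mapP => -[j b] le /= ->; have := nth_index (0%N, false) le.
move: (index_mem (j, b) l); rewrite le; set k := index _ _ => lt_k ek.
have : chain x l k = 0.
  apply/le_anti; rewrite chain_ge0 // andbT (le_trans _ h0) //.
  exact: chain_homo.
rewrite /chain (nth_map (0%N, false)) // ek /signed_val /= => /eqP.
by rewrite mulf_eq0 signr_eq0 => /eqP.
Qed.

Lemma chamber_cone n a W l : convex_cone (chamber n a W l).
Proof.
move=> x y s t [x1 x2 x3] [y1 y2 y3] s0 t0; split.
- by rewrite comb_lin addmx_sub // scalemx_sub.
- by move=> k; rewrite !chain_lin lerD // ler_pM2l.
- by rewrite chain_lin addr_gt0 // mulr_gt0.
Qed.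

Lemma combS n x a : comb n.+1 x a = comb n x a + x n *: a n.
Proof. by rewrite /comb big_ord_recr. Qed.

Lemma eq_comb n x y a b : (forall i, (i < n)%N -> x i *: a i = y i *: b i) ->
  comb n x a = comb n y b.
Proof. by move=> h; apply: eq_bigr => i _; apply: h. Qed.

Lemma eq_chain n x y l : l \in signed_orders n ->
  (forall i, (i < n)%N -> x i = y i) -> chain x l =1 chain y l.
Proof.
move=> hl h k; congr (nth _ _ _); apply/eq_in_map => -[j b] le.
rewrite /signed_val h //=.
have : j \in map fst l by apply/mapP; exists (j, b).
by rewrite (perm_mem (perm_signed_orders hl)) mem_iota.
Qed.

(** With [n.+1] coordinates but an order of only [n] indices, [chamber] is the cylinder over a
    chamber. Inserting [n] at [p] confines the signed last coordinate between neighbouring chain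
    values, with no upper bound at [p = 0]. *)
Lemma hit_insert n a W l p b : generic n.+1 a W 1 -> l \in signed_orders n ->
  (p <= n)%N ->
  `[< hit n.+1 a W (insert l p (n, b)) >] = nonvoid (fun x =>
    [/\ chamber n.+1 a W l x, (0 < p)%N -> (-1) ^+ b * x n <= chain x l p.-1
     & chain x l p <= (-1) ^+ b * x n]) :> nat.
Proof.
move=> ga hl hp; apply: eq_nonvoid => x.
have hp' : (p <= size l)%N by rewrite (size_signed_order hl).
have ci_lt k : (k < p)%N -> chain x (insert l p (n, b)) k = chain x l k.
  by move=> kp; rewrite chain_insert // kp.
have ci_eq : chain x (insert l p (n, b)) p = (-1) ^+ b * x n.
  by rewrite chain_insert // ltnn eqxx.
have ci_gt k : (p <= k)%N -> chain x (insert l p (n, b)) k.+1 = chain x l k.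
  by move=> pk; rewrite chain_insert // !ifF //; lia.
split=> [[Wx cx c0]|[[Wx cx c0] c1 c2]].
- have cp : chain x l p <= (-1) ^+ b * x n by rewrite -ci_eq -ci_gt.
  have cp1 : (0 < p)%N -> (-1) ^+ b * x n <= chain x l p.-1.
    move=> p0; rewrite -ci_lt ?prednK // -ci_eq.
    by have := cx p.-1; rewrite prednK.
  have cl k : chain x l k.+1 <= chain x l k.
    have [kp|pk|ekp] := ltngtP k.+1 p.
    + by rewrite -!ci_lt // ltnW.
    + by rewrite -!ci_gt // ltnW.
    + rewrite ekp (le_trans cp) //.
      by have := cp1; rewrite -ekp; apply.
  (* What could fail is a point whose only nonzero coordinate is the last one. It has a single
     absolute value, so genericity with [c = 1] excludes it. *)
  split=> //; split=> //; rewrite ltNge; apply/negP => l0.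
  have x0 := chain_null hl cl l0.
  have := c0; case: (posnP p) => [p0|p0]; last by rewrite ci_lt // ltNge l0.
  move: ci_eq; rewrite p0 => ->.
  suff -> : x n = 0 by rewrite mulr0 ltxx.
  apply: (ga x [:: `|x n|]) => // i; rewrite ltnS leq_eqVlt inE.
  by case/orP => [/eqP -> //|/x0 ->]; rewrite eqxx.
- split=> //.
    move=> k; have [kp|pk|ekp] := ltngtP k.+1 p.
    + by rewrite !ci_lt // ltnW.
    + rewrite ltnS in pk; rewrite ci_gt //.
      move: pk; rewrite leq_eqVlt => /orP[/eqP <-|]; first by rewrite ci_eq.
      by case: (k) => // m pm; rewrite ci_gt.
    + by rewrite ekp ci_eq ci_lt -?ekp //; move: c1; rewrite -ekp; apply.
  have := posnP p; case=> p0; last by rewrite ci_lt.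
  by move: ci_eq c2; rewrite p0 => ->; apply: lt_le_trans.
Qed.

Lemma linear_signed_coord n b l q :
  linear_form (fun x => (-1) ^+ b * x n - chain x l q).
Proof. by move=> x y s t; rewrite chain_lin; ring. Qed.

(** Passing from [q] to [q.+1] cuts the piece bounded below by [chain x l q.+1] along the hyperplane
    where the signed last coordinate equals [chain x l q]. For [q = n] the bound is the default
    value [0], so the pieces fill a half cylinder. *)
Lemma sum_slots n a W l b q : generic n.+1 a W 1 -> l \in signed_orders n ->
  (q <= n)%N ->
  (\sum_(0 <= p < q.+1) `[< hit n.+1 a W (insert l p (n, b)) >] =
   nonvoid (fun x => chamber n.+1 a W l x /\ (chain x l q <= (-1) ^+ b * x n)%R) +
   \sum_(0 <= p < q)
     nonvoid (fun x =>
       chamber n.+1 a W l x /\ ((-1) ^+ b * x n)%R = chain x l p))%N.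
Proof.
move=> ga hl; elim: q => [_|q IHq qn].
  rewrite big_nat1 big_geq // addn0 hit_insert //.
  by apply: eq_nonvoid => x; split=> [[]|[]].
rewrite big_nat_recr //= IHq; last exact: ltnW.
rewrite [in RHS]big_nat_recr //= hit_insert //.
rewrite addnAC [in RHS]addnCA [in RHS]addnC; congr (_ + _)%N.
pose K x := chamber n.+1 a W l x /\ chain x l q.+1 <= (-1) ^+ b * x n.
apply: (@nonvoid_split K _ _ _ (fun x => (-1) ^+ b * x n - chain x l q)).
- move=> x y s t [Kx hx] [Ky hy] s0 t0; split; first exact: chamber_cone.
  rewrite chain_lin mulrDr ![(-1) ^+ b * (_ * _)]mulrCA.
  by rewrite lerD // ler_pM2l.
- exact: linear_signed_coord.
- move=> x; rewrite subr_ge0; split=> [[Kx hx]|[[Kx _] hx]] //.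
  by split=> //; split=> //; apply: le_trans hx; case: Kx.
- move=> x; rewrite subr_le0; split=> [[Kx hx hx']|[[Kx hx] hx']] //.
  by split; [split|apply: hx].
- move=> x; split=> [[Kx hx]|[[Kx hx] /eqP]].
    by split; [split=> //; rewrite hx; case: Kx|rewrite hx subrr].
  by rewrite subr_eq0 => /eqP.
Qed.

(** The last coordinate is unconstrained by the chain, so it can supply any multiple of [a n]. *)
Lemma chamber_proj n a (W : 'M[R]_d) l : l \in signed_orders n ->
  nonvoid (chamber n.+1 a W l) = `[< hit n a (W + a n)%MS l >].
Proof.
move=> hl; congr nat_of_bool; apply/asboolP/asboolP => -[x [Wx cx c0]].
  exists x; split=> //; move: Wx; rewrite combS => Wx.
  rewrite -[comb n x a](addrK (x n *: a n)) addmx_sub //.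
    exact: submx_trans Wx (addsmxSl _ _).
  by rewrite eqmx_opp scalemx_sub // addsmxSr.
case/sub_addsmxP: Wx => -[u v] /= hu.
rewrite [v]mx11_scalar mul_scalar_mx in hu.
exists (fun i => if i == n then - v 0 0 else x i).
have ex i : (i < n)%N -> (if i == n then - v 0 0 else x i) = x i.
  by move=> /ltn_eqF ->.
split=> [|k|]; rewrite ?(eq_chain hl ex) //.
rewrite combS eqxx (@eq_comb n _ x a a) => [|i /ex -> //].
by rewrite hu scaleNr addrK submxMl.
Qed.

(* Substituting [x_n = (-1)^b x_j] merges the [n]-th step into the [j]-th. *)
Definition fold n a j (b : bool) i : 'rV[R]_d :=
  if i == j then a j + (-1) ^+ b *: a n else a i.

Lemma comb_fold n x a j (b : bool) : (j < n)%N -> x n = (-1) ^+ b * x j ->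
  comb n x (fold n a j b) = comb n.+1 x a.
Proof.
move=> jn xn; rewrite combS /comb.
rewrite (bigD1 (Ordinal jn)) // [in RHS](bigD1 (Ordinal jn)) //= /fold eqxx.
rewrite scalerDr scalerA [x j * _]mulrC -xn -!addrA; congr (_ + _).
rewrite [RHS]addrC; congr (_ + _); apply: eq_bigr => i /= ij.
by rewrite ifF //; apply/negbTE.
Qed.

Lemma chamber_slice0 n a (W : 'M[R]_d) l : l \in signed_orders n ->
  nonvoid (fun x => chamber n.+1 a W l x /\ x n = 0) = `[< hit n a W l >].
Proof.
move=> hl; congr nat_of_bool; apply/asboolP/asboolP => -[x].
  move=> [[Wx cx c0] xn]; exists x; split=> //.
  by move: Wx; rewrite combS xn scale0r addr0.
move=> [Wx cx c0]; exists (fun i => if i == n then 0 else x i).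
have ex i : (i < n)%N -> (if i == n then 0 else x i) = x i.
  by move=> /ltn_eqF ->.
rewrite eqxx; split=> //; split=> [|k|]; rewrite ?(eq_chain hl ex) //.
rewrite combS eqxx scale0r addr0 (@eq_comb n _ x a a) // => i /ex -> //.
Qed.

(** On the slice the last coordinate is, up to sign, the one recorded at place [p] of [l]; the sign
    combines [b] with the recorded one. *)
Lemma chamber_slice n a (W : 'M[R]_d) l (b : bool) p : l \in signed_orders n ->
  (p < n)%N ->
  nonvoid (fun x => chamber n.+1 a W l x /\ (-1) ^+ b * x n = chain x l p) =
  `[< hit n (fold n a (nth (0%N, false) l p).1
                      (b (+) (nth (0%N, false) l p).2)) W l >].
Proof.
move=> hl pn; have pl : (p < size l)%N by rewrite (size_signed_order hl).
have := mem_nth (0%N, false) pl.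
have cp x : chain x l p = signed_val x (nth (0%N, false) l p).
  by rewrite /chain (nth_map (0%N, false)).
case: (nth _ l p) cp => j c /= cp jl.
have jn : (j < n)%N.
  have : j \in map fst l by apply/mapP; exists (j, c).
  by rewrite (perm_mem (perm_signed_orders hl)) mem_iota.
have eqn x : (-1) ^+ b * x n = chain x l p <-> x n = (-1) ^+ (b (+) c) * x j.
  rewrite cp /signed_val /= signr_addb -mulrA; split=> [<-|->].
    by rewrite mulrA -signr_addb addbb mul1r.
  by rewrite mulrA -signr_addb addbb mul1r.
congr nat_of_bool; apply/asboolP/asboolP => -[x].
  by move=> [[Wx cx c0] /eqn xn]; exists x; split=> //; rewrite comb_fold.
move=> [Wx cx c0].
exists (fun i => if i == n then (-1) ^+ (b (+) c) * x j else x i).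
have ex i : (i < n)%N ->
    (if i == n then (-1) ^+ (b (+) c) * x j else x i) = x i.
  by move=> /ltn_eqF ->.
split; last by apply/eqn; rewrite eqxx ex.
split=> [|k|]; rewrite ?(eq_chain hl ex) //.
rewrite -(@comb_fold _ _ _ j (b (+) c)) ?eqxx ?ex //.
by rewrite (@eq_comb n _ x _ (fold n a j (b (+) c))) // => i /ex ->.
Qed.

(** Over each chamber the two half cylinders are glued along [x n = 0]. This leaves the whole
    cylinder, counted by projection, and one term per slice. *)
Lemma hits_cons n a (W : 'M[R]_d) : generic n.+1 a W 1 ->
  hits n.+1 a W = (hits n a (W + a n)%MS + hits n a W +
   \sum_(0 <= j < n) (hits n (fold n a j false) W +
                      hits n (fold n a j true) W))%N.
Proof.
move=> ga; rewrite /hits signed_orders_bigS.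
under [X in (_ + X)%N]eq_bigr do rewrite -big_split /=.
rewrite [X in (_ + X)%N]exchange_big -!big_split /= [LHS]big_seq [RHS]big_seq.
apply: eq_bigr => l hl.
rewrite !sum_slots // addnACA; congr (_ + _)%N.
  have -> := @nonvoid_split (chamber n.+1 a W l) _ _
    (fun x => chamber n.+1 a W l x /\ x n = 0) (fun x => x n).
  - by rewrite chamber_proj // chamber_slice0.
  - exact: chamber_cone.
  - by [].
  - move=> x; rewrite chain_default ?(size_signed_order hl) //.
    by rewrite expr0 mul1r.
  - move=> x; rewrite chain_default ?(size_signed_order hl) //.
    by rewrite expr1 mulN1r oppr_ge0.
  - by [].
rewrite -big_split /=.
pose F j b : nat := `[< hit n (fold n a j b) W l >].
pose G (e : nat * bool) := (F e.1 false + F e.1 true)%N.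
(* The sign at place [p] only swaps the two folds, and the indices in [l] permute those below [n],
   so the sum over places becomes a sum over indices. *)
transitivity (\sum_(0 <= p < n) G (nth (0%N, false) l p))%N.
  apply: eq_big_nat => p pn; rewrite (chamber_slice a W false hl pn).
  rewrite (chamber_slice a W true hl pn) /G /F.
  by case: (nth _ l p) => j [] /=; rewrite // addnC.
rewrite -[in LHS](size_signed_order hl) -(big_nth _ xpredT G).
rewrite -(big_map fst xpredT (fun j => F j false + F j true)%N).
by rewrite (perm_big _ (perm_signed_orders hl)) /index_iota subn0.
Qed.
(** At most [n] absolute values occur, so genericity leaves only the origin. *)
Lemma hits_eq0 n a (W : 'M[R]_d) c : (n <= c)%N -> generic n a W c ->
  hits n a W = 0%N.
Proof.
move=> nc ga; rewrite /hits big_seq big1 // => l hl.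
rewrite asboolF // => -[x [Wx _ +]].
have x0 : forall i, (i < n)%N -> x i = 0.
  apply: (ga x [seq `|x i| | i <- iota 0 n]) => //.
    by rewrite size_map size_iota.
  by move=> i ni _; apply: map_f; rewrite mem_iota.
rewrite (eq_chain hl (y := fun i => 0 * x i + 0 * x i)).
  by rewrite chain_lin !mul0r addr0 ltxx.
by move=> i /x0 ->; rewrite mulr0 addr0.
Qed.

Lemma chain_surj n l g : l \in signed_orders n ->
  (forall k, (n <= k)%N -> g k = 0) -> exists x, chain x l =1 g.
Proof.
move=> hl g0; have ul : uniq (map fst l).
  by rewrite (perm_uniq (perm_signed_orders hl)) iota_uniq.
exists (fun i => (-1) ^+ (nth (0%N, false) l (index i (map fst l))).2
                  * g (index i (map fst l))).
move=> k; have [kl|kl] := ltnP k (size l); last first.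
  by rewrite chain_default // g0 // -(size_signed_order hl).
rewrite /chain (nth_map (0%N, false)) // /signed_val.
rewrite -(nth_map _ 0%N) // index_uniq ?size_map //.
by rewrite mulrA -signr_addb addbb mul1r.
Qed.

(** No linear condition remains, so every chamber is met; one coordinate at least is required for a
    positive first chain value. *)
Lemma hits_full n a (W : 'M[R]_d) : row_full W ->
  hits n.+1 a W = (2 ^ n.+1 * n.+1`!)%N.
Proof.
move=> fW; rewrite -size_signed_orders -sum1_size /hits !big_seq.
apply: eq_bigr => l hl; rewrite asboolT //.
have [|x xE] := chain_surj (g := fun k => (k < n.+1)%:R) hl.
  by move=> k; rewrite leqNgt => /negbTE ->.
exists x; split; rewrite ?xE //; first exact: submx_full.
move=> k; rewrite !xE ler_nat; case: (ltnP k.+1) => // kn.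
by rewrite (ltnW kn).
Qed.

Lemma genericW n a (W : 'M[R]_d) c c' : (c <= c')%N ->
  generic n a W c' -> generic n a W c.
Proof. by move=> cc ga x s sc; apply: ga; apply: leq_trans cc. Qed.

Lemma generic_restrict n a (W : 'M[R]_d) c :
  generic n.+1 a W c -> generic n a W c.
Proof.
move=> ga x s sc Wx hx i ni.
have ex i' : (i' < n)%N -> (if i' == n then 0 else x i') = x i'.
  by move=> /ltn_eqF ->.
rewrite -ex //; apply: (ga (fun i => if i == n then 0 else x i) s) => //.
- by rewrite combS eqxx scale0r addr0 (@eq_comb n _ x a a) // => j /ex ->.
- by move=> j jn; case: ifP => [_|jn']; rewrite ?eqxx // => /hx; apply; lia.
- exact: ltnW.
Qed.

(** The restored coordinate has the absolute value of [x j], so no new value appears. *)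
Lemma generic_fold n a (W : 'M[R]_d) c j b : (j < n)%N ->
  generic n.+1 a W c -> generic n (fold n a j b) W c.
Proof.
move=> jn ga x s sc Wx hx i ni.
pose y i := if i == n then (-1) ^+ b * x j else x i.
have ex i' : (i' < n)%N -> y i' = x i' by rewrite /y => /ltn_eqF ->.
rewrite -ex //; apply: (ga y s) => //; last exact: ltnW.
  rewrite -(@comb_fold _ _ _ j b) //; last by rewrite (ex j) // /y eqxx.
  by rewrite (@eq_comb n _ x _ (fold n a j b)) // => k /ex ->.
move=> k kn; rewrite /y; case: ifP => [_|kn']; last by apply: hx; lia.
by rewrite normrMsign mulf_eq0 signr_eq0 => /hx; apply.
Qed.

(** The restored coordinate may bring a new absolute value, which uses up one of the [c.+1]
    allowed. *)
Lemma generic_proj n a (W : 'M[R]_d) c :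
  generic n.+1 a W c.+1 -> generic n a (W + a n)%MS c.
Proof.
move=> ga x s sc /sub_addsmxP[[u v]] /= hu hx i ni.
rewrite [v]mx11_scalar mul_scalar_mx in hu.
pose y i := if i == n then - v 0 0 else x i.
have ex i' : (i' < n)%N -> y i' = x i' by rewrite /y => /ltn_eqF ->.
rewrite -ex //; apply: (ga y (`|y n| :: s)) => //; last exact: ltnW.
  have -> : comb n.+1 y a = comb n y a - v 0 0 *: a n.
    by rewrite combS /y eqxx scaleNr.
  rewrite (@eq_comb n _ x a a) => [|k /ex -> //].
  by rewrite hu addrK submxMl.
move=> k kn; have [-> _|kn'] := eqVneq k n; first by rewrite inE eqxx.
have kn2 : (k < n)%N by lia.
by rewrite ex // => /hx kx; rewrite inE kx ?orbT.
Qed.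

Lemma rank_adds_notin (W : 'M[R]_d) (v : 'rV[R]_d) :
  ~~ (v <= W)%MS -> \rank (W + v)%MS = (\rank W).+1.
Proof.
move=> nv; apply/eqP; rewrite eqn_leq; apply/andP; split.
  apply: leq_trans (mxrank_adds_leqif W v) _.
  by rewrite -[X in (_ <= X)%N]addn1 leq_add2l rank_leq_row.
rewrite ltn_neqAle mxrankS ?addsmxSl // andbT.
apply: contra nv => /eqP e.
rewrite (submx_trans (addsmxSr W v)) //.
by rewrite -(geq_leqif (mxrank_leqif_sup (addsmxSl W v))) e.
Qed.

(** * Coefficient sums of the type B polynomial and the chamber count *)

Definition Bpoly n : {poly int} := \prod_(i < n) ('X + (2 * i + 1)%:R%:P).

(** The tail [p_(c+1) + p_(c+3) + ...], complete once [N] is at least the size of [p]. *)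
Definition alt_tail N (p : {poly int}) c : int :=
  \sum_(k < N | (c < k)%N && odd (k - c)) p`_k.

Lemma size_Bpoly n : size (Bpoly n) = n.+1.
Proof.
rewrite /Bpoly (eq_bigr (fun i : 'I_n => 'X - (- (2 * i + 1)%:R)%:P)).
  by rewrite size_prod_XsubC /index_enum -enumT size_enum_ord.
by move=> i _; rewrite polyCN opprK.
Qed.

Lemma Bpoly1 n : (Bpoly n).[1] = (2 ^ n * n`!)%:R.
Proof.
rewrite /Bpoly horner_prod; elim: n => [|n IHn]; first by rewrite big_ord0.
rewrite big_ord_recr /= IHn hornerD hornerX hornerC nat1r -natrM.
by congr (_ %:R); rewrite expnS factS; lia.
Qed.

Lemma BpolyN1 n : (Bpoly n.+1).[-1] = 0.
Proof.
rewrite /Bpoly horner_prod big_ord_recl /= hornerD hornerX hornerC.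
by rewrite addNr mul0r.
Qed.

(** Twice the sum of the odd coefficients is the value at [1] minus the value at [-1], and the
    factor [t + 1] kills the latter. *)
Lemma alt_tail_Bpoly0 n :
  2 * alt_tail n.+2 (Bpoly n.+1) 0 = (2 ^ n.+1 * n.+1`!)%:R.
Proof.
rewrite -Bpoly1 -[RHS]subr0 -[X in _ - X](BpolyN1 n).
rewrite !(@horner_coef_wide _ n.+2) ?size_Bpoly // -sumrB mulr_sumr.
rewrite big_mkcond; apply: eq_bigr => i _; rewrite subn0 expr1n mulr1.
rewrite -signr_odd; case: i => -[|i] hi //=; first by rewrite mulr1 subrr.
by case: (odd i) => /=; ring.
Qed.

Lemma alt_tail_eq0 n c : (n <= c)%N -> alt_tail n.+1 (Bpoly n) c = 0.
Proof.
by move=> nc; rewrite /alt_tail big1 // => k /andP[]; case: k => k /=; lia.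
Qed.

(** In [B_(n+1) = (t + 2n + 1) B_n] the factor [t] shifts coefficients by one, so it turns the tail
    after [c.+1] into the tail after [c]. *)
Lemma alt_tail_BpolyS n c :
  alt_tail n.+2 (Bpoly n.+1) c.+1 =
  alt_tail n.+1 (Bpoly n) c + (2 * n + 1)%:R * alt_tail n.+1 (Bpoly n) c.+1.
Proof.
have cB k : (Bpoly n.+1)`_k =
    (if (k == 0)%N then 0 else (Bpoly n)`_k.-1) + (2 * n + 1)%:R * (Bpoly n)`_k.
  by rewrite /Bpoly big_ord_recr /= mulrDr coefD coefMX coefMC mulrC.
rewrite /alt_tail; under eq_bigr do rewrite cB; rewrite big_split; congr (_ + _).
  by rewrite big_mkcond big_ord_recl /= add0r -big_mkcond; apply: eq_bigl.
rewrite -mulr_sumr big_mkcond big_ord_recr -big_mkcond /=; congr (_ * _).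
by rewrite [(Bpoly n)`_ _]nth_default ?size_Bpoly // if_same addr0.
Qed.

(** Both sides obey the same recursion in [n] and [c], where [c] is the codimension left by [W]. The
    base cases are a full [W] and a single coordinate with [c] positive. *)
Lemma hits_Bpoly n a (W : 'M[R]_d) c : generic n.+1 a W c ->
  (\rank W + c)%N = d ->
  (hits n.+1 a W)%:R = 2 * alt_tail n.+2 (Bpoly n.+1) c.
Proof.
elim: n a W c => [|n IHn] a W [|c] ga rW.
- by rewrite hits_full ?alt_tail_Bpoly0 // /row_full -[X in X == _]addn0 rW.
- by rewrite (@hits_eq0 _ _ _ c.+1) ?alt_tail_eq0 ?mulr0.
- by rewrite hits_full ?alt_tail_Bpoly0 // /row_full -[X in X == _]addn0 rW.
rewrite hits_cons; last exact: genericW ga.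
(* Otherwise the unit vector at [n.+1] would lie in the subspace with a single nonzero absolute
   value. *)
have nW : ~~ (a n.+1 <= W)%MS.
  apply/negP => aW; pose x (i : nat) : R := (i == n.+1)%:R.
  suff /eqP : x n.+1 = 0 by rewrite /x eqxx oner_eq0.
  apply: (ga x [:: 1]) => //; rewrite /comb.
    rewrite (bigD1 ord_max) //= big1 ?addr0 => [|i].
      by rewrite /x eqxx scale1r.
    by rewrite -val_eqE /x /= => /negbTE ->; rewrite scale0r.
  by move=> i _; rewrite /x normr_nat inE; case: (i == n.+1); rewrite ?eqxx.
rewrite !natrD (IHn _ _ c); last 2 first.
- exact: generic_proj.
- by rewrite rank_adds_notin // addSnnS.
rewrite (IHn _ _ c.+1) //; last exact: generic_restrict.
rewrite natr_sum.
(* Every fold keeps the codimension, hence has the same count; [4] is two signs times the factor [2]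
   of the statement. *)
rewrite (eq_big_nat _ _ (F2 := fun=> 4 * alt_tail n.+2 (Bpoly n.+1) c.+1)).
  rewrite big_const_nat subn0 iter_addr_0 -[_ *+ n.+1]mulr_natr.
  by rewrite (alt_tail_BpolyS n.+1) [(_ + 1)%:R]natrD [(2 * _)%:R]natrM; ring.
move=> j jn; rewrite natrD !(IHn _ _ c.+1) //; try exact: generic_fold.
by ring.
Qed.

(** Both sides are the product of [Bpoly n] and ['X + n]. *)
Lemma Dpoly_Bpoly n : Dpoly n.+1 = Bpoly n.+1 - n.+1%:R%:P * Bpoly n.
Proof.
rewrite /Dpoly /Bpoly /= [in RHS]big_ord_recr /=.
have -> : (2 * n + 1)%:R%:P = n%:R%:P + n.+1%:R%:P :> {poly int}.
  by rewrite -polyCD -natrD; congr (_ %:R%:P); lia.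
by ring.
Qed.

Lemma alt_tail_D n c : \sum_(k < n.+2 | (c < k)%N && odd (k - c)) D n.+1 k =
  alt_tail n.+2 (Bpoly n.+1) c - n.+1%:R * alt_tail n.+1 (Bpoly n) c.
Proof.
rewrite /alt_tail mulr_sumr.
have -> : \sum_(k < n.+1 | (c < k)%N && odd (k - c)) n.+1%:R * (Bpoly n)`_k =
    \sum_(k < n.+2 | (c < k)%N && odd (k - c)) n.+1%:R * (Bpoly n)`_k.
  rewrite [RHS]big_mkcond big_ord_recr -big_mkcond /=.
  by rewrite [(Bpoly n)`_ n.+1]nth_default ?size_Bpoly // mulr0 if_same addr0.
by rewrite -sumrB; apply: eq_bigr => k _; rewrite /D Dpoly_Bpoly coefB coefCM.
Qed.
End SignedOrders.

(** * Weights on the steps of a reordered walk *)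

Section Walk.
Variables (R : realFieldType) (d : nat).
Implicit Types (x g : nat -> R) (l : seq (nat * bool)) (b : nat -> 'rV[R]_d).

Definition signed_step b (e : nat * bool) : 'rV[R]_d := (-1) ^+ e.2 *: b e.1.

Definition walk_steps b l (k : nat) := signed_step b (nth (0%N, false) l k).

(* By [abel_sum], [g k - g k.+1] are the weights of the partial sums. *)
Definition encloses n b : Prop := exists g,
  [/\ forall k, g k.+1 <= g k, 0 < g 0%N, forall k, (n <= k)%N -> g k = 0
    & comb n g b = 0].

Lemma mem_signed_orders n l :
  perm_eq (map fst l) (iota 0 n) -> l \in signed_orders n.
Proof.
elim: n l => [|n IHn] l hl.
  by move/perm_size: hl; rewrite size_map => /size0nil ->.
have /mapP[[m c] el em] : n \in map fst l.
  by rewrite (perm_mem hl) mem_iota ltnSn.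
rewrite (esym em : m = n) in el; case/splitPr: el hl => u v.
rewrite -[in iota _ _]addn1 iotaD map_cat map_cons -cat1s perm_catCA.
rewrite perm_sym perm_catC perm_cat2l perm_sym -map_cat => /IHn uv.
have -> : u ++ (n, c) :: v = insert (u ++ v) (size u) (n, c).
  by rewrite /insert take_size_cat // drop_size_cat.
rewrite signed_ordersS.
apply: (allpairs_f (fun l z => insert l z.1 (n, z.2)) uv (y := (size u, c))).
rewrite /slots; apply: allpairs_f; last by case: (c).
rewrite mem_iota /= add0n ltnS -(size_signed_order uv) size_cat.
exact: leq_addr.
Qed.

Lemma comb_chain n l x b : l \in signed_orders n ->
  comb n (chain x l) (walk_steps b l) = comb n x b.
Proof.
move=> hl; rewrite /comb.
rewrite -(big_mkord xpredT (fun k => chain x l k *: walk_steps b l k)).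
rewrite -(big_mkord xpredT (fun k => x k *: b k)).
transitivity (\sum_(0 <= k < n) (fun e : nat * bool => x e.1 *: b e.1)
    (nth (0%N, false) l k)).
  apply: eq_big_nat => k /andP[_ kn].
  rewrite /chain (nth_map (0%N, false)) ?(size_signed_order hl) //.
  rewrite /walk_steps /signed_step /signed_val scalerA mulrAC -signr_addb.
  by rewrite addbb mul1r.
rewrite -[in LHS](size_signed_order hl).
rewrite -(big_nth _ xpredT (fun e : nat * bool => x e.1 *: b e.1)).
rewrite -(big_map fst xpredT (fun j => x j *: b j)).
by rewrite (perm_big _ (perm_signed_orders hl)) /index_iota subn0.
Qed.

(** The chain values of a point of the chamber serve as weights of the reordered signed steps, and
    [chain_surj] recovers a point from the weights. *)
Lemma hit_encloses n l b : l \in signed_orders n ->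
  hit n b (0 : 'M[R]_d) l <-> encloses n (walk_steps b l).
Proof.
move=> hl; split=> [[x [Wx cx c0]]|[g [g1 g2 g3 g4]]].
  exists (chain x l); split=> //.
    by move=> k; rewrite -(size_signed_order hl); exact: chain_default.
  by rewrite comb_chain //; apply/eqP; rewrite -submx0.
have [x xg] := chain_surj hl g3; exists x.
split=> [|k|]; rewrite ?xg // submx0 -(comb_chain _ _ hl) -[X in _ == X]g4.
by apply/eqP; apply: eq_comb => i _; rewrite xg.
Qed.

Lemma abel_sum N g b :
  \sum_(k < N) (g k - g k.+1) *: (\sum_(i < k.+1) b i) =
  comb N g b - g N *: \sum_(i < N) b i.
Proof.
elim: N => [|N IHN]; first by rewrite /comb !big_ord0 scaler0 subrr.
rewrite big_ord_recr /= IHN combS [in RHS]big_ord_recr /= [in LHS]big_ord_recr /=.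
by apply/rowP => j; rewrite !mxE; ring.
Qed.

Lemma encloses_eq n b b' : (forall k, (k < n)%N -> b k = b' k) ->
  encloses n b -> encloses n b'.
Proof.
move=> bb [g [g1 g2 g3 g4]]; exists g; split=> //.
by rewrite -g4; apply: eq_comb => k /bb ->.
Qed.

Definition flip_step n b (i : nat) : 'rV[R]_d := if i == n then - b i else b i.

(** The last steps of the two walks are opposite, so a suitable combination of their weights no
    longer involves them. This describes the common part in the inclusion and exclusion. *)
Lemma encloses_flip n b : (0 < n)%N ->
  encloses n.+1 b /\ encloses n.+1 (flip_step n b) <-> encloses n b.
Proof.
move=> n0; have fl k : (k < n)%N -> flip_step n b k = b k.
  by rewrite /flip_step => /ltn_eqF ->.
split; last first.
  move=> [g [g1 g2 g3 g4]]; split; exists g; split=> //.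
  - by move=> k /ltnW; apply: g3.
  - by rewrite combS g3 // scale0r addr0.
  - by move=> k /ltnW; apply: g3.
  - rewrite combS g3 // scale0r addr0 -g4.
    by apply: eq_comb => k /fl ->.
move=> [[g [g1 g2 g3 g4]] [h [h1 h2 h3]]].
rewrite combS /flip_step eqxx -/(flip_step n b) scalerN.
rewrite (@eq_comb _ _ n h h _ b) => [h4|k /fl -> //].
have mono (f : nat -> R) : (forall k, f k.+1 <= f k) ->
    (forall k, (n.+1 <= k)%N -> f k = 0) -> 0 <= f n.
  by move=> f1 f2; rewrite -(f2 n.+1).
have := mono g g1 g3; have := mono h h1 h3.
(* A sequence whose last weight vanishes already serves for [n] steps. *)
rewrite le_eqVlt => /orP[/eqP hn _|hn].
  exists h; split=> //; first by move=> k; rewrite leq_eqVlt => /orP[/eqP <-|/h3].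
  by rewrite -h4 -hn scale0r subr0.
rewrite le_eqVlt => /orP[/eqP gn|gn].
  exists g; split=> //; first by move=> k; rewrite leq_eqVlt => /orP[/eqP <-|/g3].
  by rewrite -g4 combS -gn scale0r addr0.
(* With coefficients [h n] and [g n] the contributions of [b n] cancel. Truncation at [n] keeps the
   sequence nonincreasing because its values are nonnegative. *)
exists (fun i => if (i < n)%N then h n * g i + g n * h i else 0); split.
- move=> k; case: ltnP => [kn|kn].
    by rewrite ltnW // lerD // ler_pM2l.
  case: ltnP => // kn'; have -> : k = n.-1 by lia.
  have mono' (f : nat -> R) :
      (forall k, f k.+1 <= f k) -> 0 < f n -> 0 <= f n.-1.
    by move=> f1 fn; rewrite (le_trans (ltW fn)) // -{1}(prednK n0).
  by apply: addr_ge0; apply: mulr_ge0; rewrite ?mono' //; apply: ltW.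
- by rewrite n0 addr_gt0 // mulr_gt0.
- by move=> k; rewrite leqNgt => /negbTE ->.
rewrite (@eq_comb _ _ n _ (fun i => h n * g i + g n * h i) _ b); last first.
  by move=> k ->.
rewrite comb_lin; move: g4 h4; rewrite combS => /eqP; rewrite addr_eq0 => /eqP ->.
move=> /eqP; rewrite subr_eq0 => /eqP ->.
by rewrite scalerN !scalerA mulrC addNr.
Qed.

Lemma sum_option (V : nmodType) (I : finType) (F : option I -> V) :
  \sum_o F o = F None + \sum_i F (Some i).
Proof.
rewrite (bigD1 None) //=; congr (_ + _).
rewrite (reindex_omap Some id) => [|[]] //=.
by apply: eq_bigl => i; rewrite eqxx.
Qed.

Lemma sum_decrements N g : \sum_(k < N) (g k - g k.+1) = g 0%N - g N.
Proof.
rewrite -(big_mkord xpredT (fun k => g k - g k.+1)).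
rewrite (@telescope_sumr_eq _ 0 N (fun k => - g k)) //; last first.
  by move=> k _; rewrite opprK addrC.
by rewrite opprK addrC.
Qed.

Lemma decrements_comb n g b : g n = 0 ->
  \sum_(k < n) (g k - g k.+1) *: \sum_(i < k.+1) b i = comb n g b.
Proof. by move=> gn; rewrite abel_sum gn scale0r subr0. Qed.
End Walk.

(** * Convex hulls and general position *)

Section ConvHull.
Variables (R : realType) (d n : nat) (xi : 'I_n.+1 -> 'rV[R]_d).
Variable b : nat -> 'rV[R]_d.
Hypothesis bxi : forall i : 'I_n.+1, b i = xi i.

Lemma Ssum_sum (k : 'I_n.+1) : Ssum xi k = \sum_(i < k.+1) b i.
Proof.
rewrite (big_ord_widen n.+1) ?ltn_ord //; apply: eq_bigr => i _.
by rewrite bxi.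
Qed.

Lemma Sstar_sum : Sstar xi = \sum_(i < n.+1) flip_step n b i.
Proof. by apply: eq_bigr => i _; rewrite /flip_step bxi. Qed.

Lemma sum_flip_step k : (k < n)%N ->
  \sum_(i < k.+1) flip_step n b i = \sum_(i < k.+1) b i.
Proof.
move=> kn; apply: eq_bigr => -[i /= ik] _.
by rewrite /flip_step ltn_eqF // (leq_trans ik).
Qed.

Lemma Ssum'_sum (k : 'I_n.+1) :
  Ssum' xi k = \sum_(i < k.+1) flip_step n b i.
Proof.
rewrite /Ssum' /=; case: eqP => [->|/eqP kn]; first exact: Sstar_sum.
by rewrite sum_flip_step ?Ssum_sum // ltn_neqAle kn -ltnS ltn_ord.
Qed.

(** The two endpoints add up to twice the preceding partial sum, so equal masses on them can be
    moved there. Then only one endpoint carries mass, which decides between the walk and its flip.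
    Conversely, decrements of the weights divided by the first weight are convex coefficients. *)
Lemma conv_hull_encloses : (0 < n)%N ->
  conv_hull (Spts xi) 0 <->
  encloses n.+1 b \/ encloses n.+1 (flip_step n b).
Proof.
move=> n0; split=> [[w [w0 [w1 wS]]]|].
  pose w' k := w (Some (inord k)).
  (* Summation by parts: the tail sums of the masses are the weights of the steps. *)
  pose G i := \sum_(i <= k < n.+1) w' k.
  have w'0 k : 0 <= w' k by rewrite w0.
  have GS i : (i < n.+1)%N -> G i - G i.+1 = w' i.
    by move=> ni; rewrite /G big_ltn // addrK.
  have Gn : G n = w' n by rewrite /G big_nat1.
  have GnS : G n.+1 = 0 by rewrite /G big_geq.
  have G0 : w None + G 0%N = 1.
    rewrite -w1 sum_option; congr (_ + _); rewrite /G big_mkord.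
    by apply: eq_bigr => i _; rewrite /w' inord_val.
  have {}wS : w None *: comb n.+1 (fun=> 1) (flip_step n b) + comb n.+1 G b = 0.
    rewrite -wS sum_option; congr (_ + _).
      rewrite /= Sstar_sum; congr (_ *: _).
      by apply: eq_bigr => i _; rewrite scale1r.
    rewrite -decrements_comb //; apply: eq_bigr => i _.
    by rewrite GS // /w' inord_val /= Ssum_sum.
  (* Steps before the last receive the mass of both endpoints; the last keeps [t], the larger
     endpoint mass minus the smaller. *)
  pose g (t : R) i :=
    if (i < n)%N then w None + G i else if i == n then t else 0.
  have gP t : 0 <= t -> t <= w None + G n -> [/\ forall k, g t k.+1 <= g t k,
      0 < g t 0%N & forall k, (n.+1 <= k)%N -> g t k = 0].
    move=> t0 tG; split.
    - move=> k; rewrite /g; case: (ltngtP k.+1 n) => [kn|kn|kn].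
      + by rewrite lerD2l -subr_ge0 GS ?w'0 //; lia.
      + by case: eqP.
      + apply: le_trans tG _.
        by rewrite lerD2l -kn -subr_ge0 GS ?w'0 //; lia.
    - by rewrite /g n0 G0.
    - by move=> k kn; rewrite /g ltnNge ltnW //= gtn_eqF.
  have gE t : comb n (g t) b =
      w None *: comb n (fun=> 1) b + comb n G b.
    rewrite -[comb n G b]scale1r -comb_lin.
    by apply: eq_comb => i ni; rewrite /g ni mulr1 mul1r.
  have fE x : comb n x (flip_step n b) = comb n x b.
    by apply: eq_comb => i ni; rewrite /flip_step ltn_eqF.
  have gn t : g t n = t by rewrite /g ltnn eqxx.
  move: wS; rewrite !combS fE {1}/flip_step eqxx Gn scale1r scalerDr scalerN.
  rewrite addrACA [- _ + _]addrC -scalerBl => wS.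
  have [h|h] := leP (w None) (w' n).
    left; exists (g (w' n - w None)).
    have [|//=|g1 g2 g3] := gP (w' n - w None); rewrite ?subr_ge0 //.
      by rewrite Gn; have := w0 None; lra.
    by split=> //; rewrite combS gE gn.
  right; exists (g (w None - w' n)).
  have [|//=|g1 g2 g3] := gP (w None - w' n); rewrite ?subr_ge0 ?(ltW h) //.
    by rewrite Gn; have := w'0 n; lra.
  split=> //; rewrite combS fE gE gn /flip_step eqxx scalerN.
  by rewrite -scaleNr opprB.
have mono (g : nat -> R) :
    (forall k, g k.+1 <= g k) -> forall k, 0 <= g k - g k.+1.
  by move=> g1 k; rewrite subr_ge0.
case=> -[g [g1 g2 g3 g4]]; have gS := g3 n.+1 (leqnn _).
  exists (fun o : option 'I_n.+1 =>
    if o is Some k then (g k - g k.+1) / g 0%N else 0); split.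
    by case=> // k; rewrite divr_ge0 ?mono // ltW.
  rewrite !sum_option !add0r /= scale0r add0r; split.
    by rewrite -mulr_suml sum_decrements gS subr0 divff // gt_eqF.
  under eq_bigr do rewrite Ssum_sum mulrC -scalerA.
  by rewrite -scaler_sumr decrements_comb // g4 scaler0.
have gn : 0 <= g n by rewrite -gS.
exists (fun o : option 'I_n.+1 => if o is Some k then
   if (k < n)%N then (g k - g k.+1) / g 0%N else 0 else g n / g 0%N); split.
  by case=> [k|]; [case: ifP => // _|]; rewrite divr_ge0 ?mono // ltW.
rewrite !sum_option !big_ord_recr /= ltnn addr0 scale0r addr0; split.
  rewrite (eq_bigr (fun i : 'I_n => (g i - g i.+1) / g 0%N)).
    by rewrite -mulr_suml -mulrDl sum_decrements subrKC divff // gt_eqF.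
  by move=> i _; rewrite ltn_ord.
rewrite (eq_bigr (fun i : 'I_n => (g 0%N)^-1 *:
   ((g i - g i.+1) *: \sum_(j < i.+1) flip_step n b j))); last first.
  move=> i _; rewrite ltn_ord Ssum_sum sum_flip_step //= scalerA.
  by rewrite [_^-1 * _]mulrC.
rewrite -scaler_sumr [g n / _]mulrC -scalerA -scalerDr Sstar_sum.
(* The boundary term of [abel_sum] cancels against the first [n] steps of the endpoint [Sstar]. *)
rewrite abel_sum big_ord_recr /= [g n *: (_ + _)]scalerDr [X in _ *: X]addrC.
by rewrite addrA subrK -combS g4 scaler0.
Qed.
End ConvHull.

Section GenericPosition.
Variables (R : realFieldType) (d : nat).
Implicit Types (x : nat -> R) (b : nat -> 'rV[R]_d).

(** Sort the indices by absolute value and record the signs: the closed chambers cover the space. *)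
Lemma decreasing_order n x : exists2 l, l \in signed_orders n &
  (forall k, chain x l k.+1 <= chain x l k) /\
  forall k, (k < n)%N -> exists2 i, (i < n)%N & chain x l k = `|x i|.
Proof.
pose s := sort (fun i j => `|x j| <= `|x i|) (iota 0 n).
pose l := [seq (i, x i < 0) | i <- s].
have hl : l \in signed_orders n.
  apply: mem_signed_orders; rewrite /l -map_comp map_id_in //.
  by rewrite perm_sort.
have cE k : (k < n)%N -> chain x l k = `|x (nth 0%N s k)|.
  move=> kn; have ks : (k < size s)%N by rewrite size_sort size_iota.
  rewrite /chain (nth_map (0%N, false)) ?size_map // (nth_map 0%N) //.
  by rewrite /signed_val /= [RHS]normrEsign.
have ss : sorted (fun i j => `|x j| <= `|x i|) s.
  by apply: sort_sorted => i j; apply: le_total.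
exists l => //; split=> [k|k kn].
  have [kn|nk] := ltnP k.+1 n.
    rewrite !cE //; last exact: ltnW.
    have /(sortedP 0%N) := ss; apply.
    by rewrite size_sort size_iota.
  rewrite chain_default ?(size_signed_order hl) //.
  have [kn|nk'] := ltnP k n; first by rewrite cE.
  by rewrite chain_default ?(size_signed_order hl).
exists (nth 0%N s k); last exact: cE.
have : nth 0%N s k \in s by rewrite mem_nth // size_sort size_iota.
by rewrite mem_sort mem_iota.
Qed.

Lemma extend_to_injection n (K : {set 'I_n}) : (#|K| <= d)%N -> (d <= n)%N ->
  exists2 f : {ffun 'I_d -> 'I_n}, injective f & forall k, k \in K ->
    exists j, f j = k.
Proof.
move=> Kd dn; pose s := enum K ++ enum (~: K).
have us : uniq s.
  rewrite cat_uniq !enum_uniq /= andbT; apply/hasPn => k.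
  by rewrite !mem_enum inE.
have ss : size s = n.
  by rewrite size_cat -!cardE cardsC card_ord.
have jn (j : 'I_d) : (j < size s)%N by rewrite ss (leq_trans _ dn).
exists [ffun j : 'I_d => nth (widen_ord dn j) s j].
  move=> i j; rewrite !ffunE (set_nth_default (widen_ord dn j)) //.
  by move=> /eqP; rewrite nth_uniq // => /eqP /val_inj.
move=> k kK; have ki : (index k (enum K) < #|K|)%N.
  by rewrite cardE index_mem mem_enum.
exists (Ordinal (leq_trans ki Kd)); rewrite ffunE.
by rewrite nth_cat -cardE ki nth_index // mem_enum.
Qed.

(** Along a sorted order the decrements of the chain are coefficients of partial sums, nonzero at no
    more places than there are nonzero absolute values. So at most [d] partial sums are involved,
    and their independence forces the point to vanish. *)
Lemma generic_of_free n b : (d <= n)%N ->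
  (forall l, l \in signed_orders n -> forall f : {ffun 'I_d -> 'I_n},
    injective f -> row_free
      (\matrix_(j < d) \sum_(i < (f j).+1) walk_steps b l i)) ->
  generic n b (0 : 'M[R]_d) d.
Proof.
move=> dn free x s sd; rewrite submx0 => /eqP xb xs.
have [l hl [cx cv]] := decreasing_order n x; set g := chain x l in cx cv.
pose K := [set k : 'I_n | g k != g k.+1].
have gn : g n = 0 by rewrite /g chain_default // (size_signed_order hl).
have Kg (k : 'I_n) : k \in K -> g k.+1 < g k.
  by rewrite inE lt_neqAle eq_sym => ->; rewrite cx.
(* The chain drops strictly after each place of [K], so its values there are distinct; being
   positive, they are listed in [s]. *)
have gK : {in K &, injective (fun k : 'I_n => g k)}.
  have aux (i j : 'I_n) : i \in K -> (i < j)%N -> g i != g j.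
    move=> /Kg iK ij; rewrite gt_eqF // (le_lt_trans _ iK) //.
    exact: chain_homo.
  move=> i j iK jK /eqP gij; apply/val_inj => /=.
  have [/(aux _ _ iK)|/(aux _ _ jK)|//] := ltngtP i j; first by rewrite gij.
  by rewrite eq_sym gij.
have Kd : (#|K| <= d)%N.
  rewrite (leq_trans _ sd) // cardE -(size_map (fun k : 'I_n => g k)).
  apply: uniq_leq_size.
    by rewrite map_inj_in_uniq ?enum_uniq // => i j; rewrite !mem_enum; apply: gK.
  move=> r /mapP[k]; rewrite mem_enum => kK ->; have gk := Kg _ kK.
  have [i ni gki] := cv k (ltn_ord k); rewrite gki; apply: xs => //.
  rewrite -normr_gt0 -gki (le_lt_trans _ gk) //; exact: chain_ge0.
(* Pad the places to exactly [d], the number for which independence is assumed. *)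
have [f finj fK] := extend_to_injection Kd dn.
have := free l hl f finj; rewrite -kermx_eq0 => /eqP ker0.
pose u : 'rV[R]_d := \row_j (g (f j) - g (f j).+1).
have u0 : u = 0.
  apply/eqP; rewrite -submx0 -ker0; apply/sub_kermxP.
  rewrite mulmx_sum_row; under eq_bigr do rewrite rowK mxE.
  rewrite -[RHS]xb -(comb_chain _ _ hl) -/g -decrements_comb //.
  rewrite [RHS](bigID (fun k => k \in [set f j | j : 'I_d])) /=.
  rewrite [X in _ + X]big1 ?addr0.
    rewrite big_imset => [|i j _ _]; last exact: finj.
    by apply: eq_bigl => j; rewrite inE.
  move=> k; apply: contraNeq => nz.
  have [|j <-] := fK k; last exact: imset_f.
  by rewrite inE -subr_eq0; apply: contraNneq nz => ->; rewrite scale0r.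
have K0 (k : 'I_n) : g k = g k.+1.
  apply/eqP; apply: contraT => gk; have [|j fj] := fK k; first by rewrite inE.
  move/rowP/(_ j): u0; rewrite !mxE fj => /eqP; rewrite subr_eq0.
  by move=> /eqP h; rewrite h eqxx in gk.
apply: (chain_null hl cx); rewrite -/g.
have g0 k : (k <= n)%N -> g k = g 0%N.
  by elim: k => // k IHk kn; rewrite -(K0 (Ordinal kn)) IHk // ltnW.
by rewrite -(g0 n) // gn.
Qed.
End GenericPosition.

(** * Borel sets of matrices *)

Local Open Scope classical_set_scope.
Local Open Scope ring_scope.

Section Borel.
Variable R : realType.

Lemma mx_continuous (U : topologicalType) m n (f : U -> 'M[R]_(m, n)) :
  (forall i j, continuous (fun x => f x i j)) -> continuous f.
Proof.
move=> fc x A [P Pf sPA].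
have : \forall y \near x, forall ij : 'I_m * 'I_n, P ij.1 ij.2 (f y ij.1 ij.2).
  by apply: filter_forall => -[i j] /=; apply: (fc i j x); exact: Pf.
by apply: filterS => y Py; apply: sPA => i j; exact: (Py (i, j)).
Qed.

Lemma sum_continuous (U : topologicalType) I (r : seq I) (P : pred I)
    (F : I -> U -> R) : (forall i, P i -> continuous (F i)) ->
  continuous (fun x => \sum_(i <- r | P i) F i x).
Proof. exact: (@continuous_big R I +%R 0 P (@add_continuous R) U r F). Qed.

Lemma prod_continuous (U : topologicalType) I (r : seq I) (P : pred I)
    (F : I -> U -> R) : (forall i, P i -> continuous (F i)) ->
  continuous (fun x => \prod_(i <- r | P i) F i x).
Proof. exact: (@continuous_big R I *%R 1 P (@mul_continuous R) U r F). Qed.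

Lemma scaled_continuous (U : topologicalType) (c : R) (f : U -> R) :
  continuous f -> continuous (fun x => c * f x).
Proof. by move=> fc x; apply: cvgMl_tmp; exact: fc. Qed.

Lemma det_continuous n : continuous (fun M : 'M[R]_n => \det M).
Proof.
apply: sum_continuous => s _; apply: scaled_continuous.
by apply: prod_continuous => i _; exact: coord_continuous.
Qed.

Lemma open_row_free n : open [set M : 'M[R]_n | row_free M].
Proof.
rewrite (_ : mkset _ = (fun M : 'M[R]_n => \det M) @^-1` [set x | x != 0]).
  apply: open_comp; last exact: open_neq.
  by move=> M _; exact: det_continuous.
by apply/seteqP; split=> M /=; rewrite row_free_unit unitmxE unitfE.
Qed.

Lemma borel_open m n (A : set 'M[R]_(m, n)) : open A -> borel_mx A.
Proof. by move=> oA; apply: sub_sigma_algebra. Qed.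

Lemma borel_closed m n (A : set 'M[R]_(m, n)) : closed A -> borel_mx A.
Proof.
move=> cA; rewrite -(setCK A) -setTD; apply: sigma_algebraCD.
by apply: borel_open; exact: closed_openC.
Qed.

Lemma borelC m n (A : set 'M[R]_(m, n)) : borel_mx A -> borel_mx (~` A).
Proof. by rewrite -setTD; exact: sigma_algebraCD. Qed.

Lemma borel_preimage m n m' n' (f : 'M[R]_(m, n) -> 'M[R]_(m', n')) A :
  continuous f -> borel_mx A -> borel_mx (f @^-1` A).
Proof.
move=> fc; apply: (@smallest_sub _ _ _ [set B | borel_mx (f @^-1` B)]).
  split=> [|B|F] /=; first by rewrite preimage_set0; exact: sigma_algebra0.
    by rewrite setTD preimage_setC; exact: borelC.
  by move=> FB; rewrite preimage_bigcup; exact: sigma_algebra_bigcup.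
by move=> U oU /=; apply: borel_open; apply: open_comp => // M _; exact: fc.
Qed.

(** An open set of matrices is a countable union of boxes with rational centres and radii. *)
Lemma mx_measurable (dT : measure_display) (T : measurableType dT) m n
    (X : T -> 'M[R]_(m, n)) :
  (forall i j q r, measurable [set w | `|q - X w i j| < r]) ->
  forall A, borel_mx A -> measurable (X @^-1` A).
Proof.
move=> mX; apply: (@smallest_sub _ _ _ [set B | measurable (X @^-1` B)]).
  split=> [|B|F] /=; first by rewrite preimage_set0.
    by rewrite setTD preimage_setC; exact: measurableC.
  by move=> FB; rewrite preimage_bigcup; exact: bigcup_measurable.
move=> U oU /=.
pose box (p : 'M[rat]_(m, n) * rat) : set 'M[R]_(m, n) :=
  [set N | forall ij : 'I_m * 'I_n,
     `|ratr (p.1 ij.1 ij.2) - N ij.1 ij.2| < ratr p.2].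
have -> : U = \bigcup_(p in [set p | box p `<=` U]) box p.
  apply/seteqP; split=> [M UM|M [p /= pU]]; last exact: pU.
  have /nbhs_ballP [e /= e0 MeU] := open_nbhs_nbhs (conj oU UM).
  have /rat_in_itvoo [r] : 0 < e / 2 by rewrite divr_gt0.
  rewrite in_itv /= => /andP[r0 re].
  have near_rat i j : exists q, `|ratr q - M i j| < ratr r.
    have /rat_in_itvoo [q] : M i j - ratr r < M i j + ratr r :> R by lra.
    rewrite in_itv /= => qM; exists q; move: qM.
    by rewrite ltr_norml => /andP[h1 h2]; apply/andP; split; lra.
  have [q qM] := choice (fun ij : 'I_m * 'I_n => near_rat ij.1 ij.2).
  exists (\matrix_(i, j) q (i, j), r).
    move=> N /= hN; apply: MeU; split=> // i j.
    have := hN (i, j); have := qM (i, j); rewrite /= mxE /ball /=.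
    set a := M i j; set b := N i j; set c := ratr _ => h1 h2.
    rewrite (_ : a - b = (c - b) - (c - a)); last by ring.
    by rewrite (le_lt_trans (ler_normB _ _)) //; lra.
  by move=> [i j] /=; rewrite mxE; exact: (qM (i, j)).
rewrite preimage_bigcup bigcup_mkcond.
apply: countable_bigcupT_measurable; first exact: countableP.
move=> p; case: ifP => // _.
rewrite (_ : _ @^-1` _ = \bigcap_(ij in [set: 'I_m * 'I_n])
    [set w | `|ratr (p.1 ij.1 ij.2) - X w ij.1 ij.2| < ratr p.2]); last first.
  by apply/seteqP; split=> w /= h ij; [move=> _; exact: h|exact: (h ij I)].
by apply: fin_bigcap_measurable => //; exact: finite_finset.
Qed.

(** Tube lemma: compactness of [Q] gives a point outside one neighbourhood that works for all
    [q]. *)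
Lemma exists_compact_closed (U V : topologicalType) (Q : set U)
    (F : set (U * V)) : compact Q -> closed F ->
  closed [set v | exists2 q, Q q & F (q, v)].
Proof.
move=> /compact_near_coveringP cQ cF; rewrite -openC openE => v /= nv.
suff : \forall v' \near v, Q `<=` (fun q => ~ F (q, v')).
  by apply: filterS => v' hv' [q Qq Fq]; exact: hv' Fq.
apply: cQ => q Qq; suff : nbhs (q, v) (~` F).
  by apply: filterS => -[].
apply: open_nbhs_nbhs; split; first exact: closed_openC.
by move=> Fq; apply: nv; exists q.
Qed.

Lemma closed_condition (U : topologicalType) (f : U -> R) (D : set R) :
  continuous f -> closed D -> closed [set x | D (f x)].
Proof. by move=> fc cD; apply: (@preimage_closed _ _ f D) => // x _; exact: fc. Qed.

Variables (n d : nat).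
Implicit Types M : 'M[R]_(n.+1, d).

Definition mx_steps M (i : nat) : 'rV[R]_d := row (inord i) M.

(** Weights can be rescaled, so the first is fixed at [1] instead of being merely positive, which
    makes the set compact. Zeros from [m] on put all lengths in one space. *)
Definition normalized_weights m : set 'rV[R]_n.+1 :=
  [set v | v 0 0 = 1 /\ forall i j : 'I_n.+1,
     [/\ 0 <= v 0 i, v 0 i <= 1, (i <= j)%N -> v 0 j <= v 0 i
       & (m <= i)%N -> v 0 i = 0]].

Lemma compact_normalized_weights m : compact (normalized_weights m).
Proof.
have cB : compact [set v : 'rV[R]_n.+1 | forall i,
    (`[0%R, 1%R]%classic : set R) (v ord0 i)].
  apply: (@rV_compact _ _ (fun=> `[0%R, 1%R]%classic : set R)) => _.
  exact: segment_compact.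
apply: (subclosed_compact _ cB).
- have cont (i : 'I_n.+1) : continuous (fun v : 'rV[R]_n.+1 => v 0 i).
    exact: coord_continuous.
  rewrite (_ : normalized_weights m = [set v | v 0 0 = 1] `&`
    \bigcap_(ij in [set: 'I_n.+1 * 'I_n.+1]) ([set v | 0 <= v 0 ij.1] `&`
     [set v | v 0 ij.1 <= 1] `&`
     [set v | (ij.1 <= ij.2)%N -> 0 <= v 0 ij.1 - v 0 ij.2] `&`
     [set v | (m <= ij.1)%N -> v 0 ij.1 = 0])); last first.
    apply/seteqP; split=> v /= [v0 h]; split=> //.
      move=> [i j] _ /=; have [h1 h2 h3 h4] := h i j; split=> //; split=> //.
      by rewrite subr_ge0.
    move=> i j; have [[[h1 h2] h3] h4] := h (i, j) I; split=> //.
    by move=> /h3 /=; rewrite subr_ge0.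
  apply: closedI.
    exact: (closed_condition (cont 0) (@closed_eq R 1)).
  apply: closed_bigI => -[i j] _.
  apply: closedI; [apply: closedI; [apply: closedI|]|].
  + exact: (closed_condition (cont i) (@closed_ge R 0)).
  + exact: (closed_condition (cont i) (@closed_le R 1)).
  + case: (leqP i j) => ij /=; last first.
      rewrite [X in closed X](_ : _ = setT); first exact: closedT.
      by apply/seteqP; split=> v.
    rewrite [X in closed X](_ : _ =
      (fun v : 'rV[R]_n.+1 => v 0 i - v 0 j) @^-1` [set x | 0 <= x]).
      apply: (closed_condition _ (@closed_ge R 0)) => v.
      exact: (cvgB (cont i v) (cont j v)).
    by apply/seteqP; split=> v /=; [apply|move=> ? _].
  + case: (leqP m i) => ij /=; last first.
      rewrite [X in closed X](_ : _ = setT); first exact: closedT.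
      by apply/seteqP; split=> v.
    rewrite [X in closed X](_ : _ =
      (fun v : 'rV[R]_n.+1 => v 0 i) @^-1` [set x | x = 0]).
      exact: (closed_condition (cont i) (@closed_eq R 0)).
    by apply/seteqP; split=> v /=; [apply|move=> ? _].
- by move=> v /= [_ h] i; rewrite in_itv /=; have [-> ->] := h i i.
Qed.

Lemma closed_mulmx_eq0 :
  closed [set p : 'rV[R]_n.+1 * 'M[R]_(n.+1, d) | p.1 *m p.2 = 0].
Proof.
rewrite (_ : mkset _ = \bigcap_(c in [set: 'I_d])
    [set p : 'rV[R]_n.+1 * 'M[R]_(n.+1, d) | \sum_j p.1 0 j * p.2 j c = 0]).
  apply: closed_bigI => c _; apply: (closed_condition _ (@closed_eq R 0)).
  apply: sum_continuous => j _ p; apply: (@cvgM _ _ _ _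
    (fun p : 'rV[R]_n.+1 * 'M[R]_(n.+1, d) => p.1 0 j) (fun p => p.2 j c)).
    apply: (@continuous_comp _ _ _ fst (fun v : 'rV[R]_n.+1 => v 0 j)).
      exact: cvg_fst.
    exact: coord_continuous.
  apply: (@continuous_comp _ _ _ snd (fun M : 'M[R]_(n.+1, d) => M j c)).
    exact: cvg_snd.
  exact: coord_continuous.
apply/seteqP; split=> p /= h.
  by move=> c _ /=; move/rowP/(_ c): h; rewrite !mxE.
by apply/rowP => c; rewrite [RHS]mxE mxE; exact: (h c I).
Qed.

Lemma encloses_weights m M : (0 < m)%N -> (m <= n.+1)%N ->
  encloses m (mx_steps M) <->
  exists2 v, normalized_weights m v & v *m M = 0.
Proof.
move=> m0 mn; have mulE (g : nat -> R) (v : 'rV[R]_n.+1) c :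
    (forall i : 'I_n.+1, (i < m)%N -> v 0 i = c * g i) ->
    (forall i : 'I_n.+1, (m <= i)%N -> v 0 i = 0) ->
    v *m M = c *: comb m g (mx_steps M).
  move=> vg v0; rewrite mulmx_sum_row /comb scaler_sumr.
  rewrite (big_ord_widen n.+1 (fun i => c *: (g i *: mx_steps M i))) //.
  rewrite [RHS]big_mkcond.
  apply: eq_bigr => i _; case: ltnP => [im|mi].
    by rewrite scalerA vg // /mx_steps inord_val.
  by rewrite v0 // scale0r.
split=> [[g [g1 g2 g3 g4]]|[v [v0 v1] vM]].
  have gm i j : (i <= j)%N -> g j <= g i.
    move=> /subnK <-; elim: (j - i)%N => [|k IHk]; first by rewrite add0n.
    by rewrite addSn (le_trans (g1 _)).
  have g0 i : 0 <= g i.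
    by rewrite -(g3 (maxn i m)) ?leq_maxr // gm // leq_maxl.
  exists (\row_i ((g 0%N)^-1 * g i)).
    split; first by rewrite mxE mulVf // gt_eqF.
    move=> i j; rewrite !mxE; split.
    - by rewrite mulr_ge0 // invr_ge0.
    - by rewrite mulrC ler_pdivrMr // mul1r gm.
    - by move=> ij; rewrite ler_wpM2l ?invr_ge0 // gm.
    - by move=> mi; rewrite (g3 i) // mulr0.
  rewrite (mulE g _ (g 0%N)^-1) ?g4 ?scaler0 // => i im; rewrite mxE //.
  by rewrite (g3 i) // mulr0.
exists (fun i => if (i < m)%N then v 0 (inord i) else 0); split.
- move=> k; case: ltnP => km; last first.
    by case: ifP => // _; have [] := v1 (inord k) 0.
  rewrite (ltnW km); have [_ _ + _] := v1 (inord k) (inord k.+1).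
  by apply; rewrite !inordK //; lia.
- by rewrite m0 (_ : inord 0 = 0) ?v0 //; apply/val_inj; rewrite /= inordK.
- by move=> k; rewrite leqNgt => /negbTE ->.
rewrite -[LHS]scale1r -(mulE _ v) //.
  by move=> i im; rewrite im inord_val mul1r.
by move=> i mi; have [_ _ _ ->] := v1 i 0.
Qed.

Lemma closed_encloses m : (0 < m)%N -> (m <= n.+1)%N ->
  closed [set M | encloses m (mx_steps M)].
Proof.
move=> m0 mn; rewrite (_ : mkset _ = [set M | exists2 v, normalized_weights m v &
    [set p : 'rV[R]_n.+1 * 'M[R]_(n.+1, d) | p.1 *m p.2 = 0] (v, M)]).
  apply: exists_compact_closed; first exact: compact_normalized_weights.
  exact: closed_mulmx_eq0.
by apply/seteqP; split=> M /= /encloses_weights; apply.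
Qed.

End Borel.

(** * Averaging over the symmetry group *)

Section Averaging.
Variables (R : realType) (dT : measure_display) (T : measurableType dT).
Variables (P : probability T R).

(** Integrate the sum of the indicators, almost surely equal to [c]. *)
Lemma sum_probability_const (I : Type) (s : seq I) (E : I -> set T) (c : R) :
  (forall i, measurable (E i)) ->
  {ae P, forall w, (\sum_(i <- s) `[< E i w >])%N%:R = c} ->
  (\sum_(i <- s) P (E i) = c%:E)%E.
Proof.
move=> mE Ec.
have mI i : measurable_fun [set: T] (EFin \o (\1_(E i) : T -> R)).
  by apply/measurable_EFinP; exact: measurable_indic.
transitivity (\sum_(i <- s) \int[P]_w (\1_(E i) w : R)%:E)%E.
  by apply: eq_bigr => i _; rewrite integral_indic // setIT.
rewrite -ge0_integral_sum //.
rewrite (ae_eq_integral (cst c%:E)) //.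
- rewrite integral_cst // -[RHS]mule1; congr (_ * _)%E.
  exact: probability_setT.
- exact: emeasurable_sum.
apply: filterS Ec => w <- _ /=.
rewrite sumEFin natr_sum; congr (_%:E); apply: eq_bigr => i _.
Qed.

Lemma ae_seq (I : eqType) (s : seq I) (Q : I -> T -> Prop) :
  (forall i, i \in s -> {ae P, forall w, Q i w}) ->
  {ae P, forall w, forall i, i \in s -> Q i w}.
Proof.
elim: s => [_|i s IHs h]; first exact: aeW.
have := IHs (fun j js => h j (mem_behead (s := i :: s) js)).
have := h i (mem_head _ _).
apply: filterS2 => w Qi Qs j; rewrite inE => /predU1P[->//|]; exact: Qs.
Qed.
End Averaging.

Section RandomWalk.
Variables (R : realType) (d n : nat).
Implicit Types (M : 'M[R]_(n.+1, d)) (l : seq (nat * bool)).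

Definition act l M : 'M[R]_(n.+1, d) :=
  \matrix_(k < n.+1) walk_steps (mx_steps M) l k.

Definition flip_mx M : 'M[R]_(n.+1, d) :=
  \matrix_(k < n.+1) flip_step n (mx_steps M) k.

Lemma mx_steps_act l M k : (k < n.+1)%N ->
  mx_steps (act l M) k = walk_steps (mx_steps M) l k.
Proof. by move=> kn; rewrite /mx_steps rowK inordK. Qed.

Lemma mx_steps_flip M k : (k < n.+1)%N ->
  mx_steps (flip_mx M) k = flip_step n (mx_steps M) k.
Proof. by move=> kn; rewrite /mx_steps rowK inordK. Qed.

Lemma mx_steps_coord_continuous (e : nat * bool) j :
  continuous (fun M => signed_step (mx_steps M) e 0 j).
Proof.
rewrite (_ : (fun M => _) = fun M => (-1) ^+ e.2 * M (inord e.1) j).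
  by apply: scaled_continuous; exact: coord_continuous.
by apply/funext => M; rewrite !mxE.
Qed.

Lemma act_continuous l : continuous (act l).
Proof.
apply: mx_continuous => i j.
rewrite (_ : (fun M => _) =
    fun M => signed_step (mx_steps M) (nth (0%N, false) l i) 0 j).
  exact: mx_steps_coord_continuous.
by apply/funext => M; rewrite mxE.
Qed.

Lemma flip_mx_continuous : continuous flip_mx.
Proof.
apply: mx_continuous => i j.
rewrite (_ : (fun M => _) =
    fun M => signed_step (mx_steps M) (nat_of_ord i, i == n :> nat) 0 j).
  exact: mx_steps_coord_continuous.
apply/funext => M; rewrite !mxE /flip_step /signed_step /=.
by case: eqP => _; rewrite !mxE ?expr1 ?mulN1r ?expr0 ?mul1r.
Qed.

Definition walk_frame (f : {ffun 'I_d -> 'I_n.+1}) M : 'M[R]_d :=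
  \matrix_(j < d) \sum_(i < (f j).+1) mx_steps M i.

Lemma walk_frame_continuous f : continuous (walk_frame f).
Proof.
apply: mx_continuous => i j.
rewrite (_ : (fun M => _) = fun M => \sum_(k < (f i).+1) M (inord k) j).
  by apply: sum_continuous => k _; exact: coord_continuous.
by apply/funext => M; rewrite mxE summxE; apply: eq_bigr => k _; rewrite mxE.
Qed.

Lemma walk_frame_act f l M : walk_frame f (act l M) =
  \matrix_(j < d) \sum_(i < (f j).+1) walk_steps (mx_steps M) l i.
Proof.
apply/row_matrixP => j; rewrite !rowK; apply: eq_bigr => i _.
by rewrite mx_steps_act // (leq_trans (ltn_ord i)).
Qed.

Variables (dT : measure_display) (T : measurableType dT) (P : probability T R).
Variable X : T -> 'M[R]_(n.+1, d).
Hypothesis mX : forall A, borel_mx A -> measurable (X @^-1` A).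
Hypothesis invX : forall (s : 'S_n.+1) (eps : 'I_n.+1 -> R),
  (forall i, eps i = 1 \/ eps i = -1) -> \prod_i eps i = 1 ->
  eq_in_law P X (fun w => \matrix_(i, j) (eps i * X w (s i) j)).

(* An odd number of sign changes is not a symmetry of the law; it is one after
   flipping the last step as well. *)
Definition even_representative l : T -> 'M[R]_(n.+1, d) :=
  if parity l then flip_mx \o X else X.

Lemma law_act l A : l \in signed_orders n.+1 -> borel_mx A ->
  P ((act l \o X) @^-1` A) = P (even_representative l @^-1` A).
Proof.
move=> hl bA.
pose e (k : 'I_n.+1) := nth (0%N, false) l k.
have en k : ((e k).1 < n.+1)%N.
  have : (e k).1 \in map fst l.
    by apply: map_f; rewrite mem_nth // (size_signed_order hl).
  by rewrite (perm_mem (perm_signed_orders hl)) mem_iota.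
have einj : injective (fun k => inord (e k).1 : 'I_n.+1).
  move=> i j /(congr1 val) /=; rewrite !inordK //.
  rewrite -!(nth_map _ 0%N) ?(size_signed_order hl) // => /eqP.
  rewrite nth_uniq ?size_map ?(size_signed_order hl) //; last first.
    by rewrite (perm_uniq (perm_signed_orders hl)) iota_uniq.
  by move=> /eqP /val_inj.
pose s := perm einj.
pose eps k : R := (-1) ^+ (e k).2.
have eps1 k : eps k = 1 \/ eps k = -1.
  by rewrite /eps; case: (_.2); [right|left].
have prod_eps : \prod_k eps k = (-1) ^+ parity l.
  transitivity (\prod_(x <- l) (-1) ^+ x.2 : R).
    rewrite (big_nth (0%N, false)) (size_signed_order hl) big_mkord.
    by apply: eq_bigr.
  rewrite /parity signr_odd; elim: (l) => [|x t IHt]; first by rewrite big_nil.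
  by rewrite big_cons IHt /= exprD.
have actE M i j : act l M i j = eps i * M (s i) j.
  by rewrite !mxE permE.
rewrite /even_representative; case: ifP => pl; last first.
  rewrite [RHS](@invX s eps) ?prod_eps ?pl //.
  by congr (P _); apply/seteqP; split=> w /=;
    rewrite (_ : act l _ = \matrix_(i, j) (eps i * X w (s i) j)) //;
    apply/matrixP => i j; rewrite actE mxE.
(* Negating the last sign makes the product [1]; [flip_mx] then restores that sign. *)
pose eps' k := if k == ord_max then - eps k else eps k.
have prod_eps' : \prod_k eps' k = 1.
  rewrite (bigD1 ord_max) //= {1}/eps' eqxx mulNr.
  rewrite (eq_bigr eps) => [|k /negbTE kn]; last by rewrite /eps' kn.
  by rewrite -(bigD1 ord_max (P := xpredT)) // prod_eps pl expr1 opprK.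
have eps'1 k : eps' k = 1 \/ eps' k = -1.
  rewrite /eps'; case: ifP => _ //.
  by case: (eps1 k) => ->; [right|left; rewrite opprK].
have := @invX s eps' eps'1 prod_eps' _ (borel_preimage flip_mx_continuous bA).
move=> h; rewrite [RHS]h; congr (P _).
suff actE' w : act l (X w) = flip_mx (\matrix_(i, j) (eps' i * X w (s i) j)).
  by apply/seteqP; split=> w /=; rewrite actE'.
apply/matrixP => i j; rewrite actE [RHS]mxE /flip_step /mx_steps inord_val.
rewrite -[nat_of_ord i == n]/(i == ord_max).
by case: ifP => ni; rewrite !mxE /eps' ni ?mulNr ?opprK.
Qed.

Definition enclosing m : set 'M[R]_(n.+1, d) :=
  [set M | encloses m (mx_steps M)].

Lemma borel_enclosing m : (0 < m)%N -> (m <= n.+1)%N -> borel_mx (enclosing m).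
Proof. by move=> m0 mn; apply: borel_closed; exact: closed_encloses. Qed.

Lemma measurable_flip A : borel_mx A -> measurable ((flip_mx \o X) @^-1` A).
Proof.
by move=> bA; exact: (mX (borel_preimage flip_mx_continuous bA)).
Qed.

Lemma measurable_act l A : borel_mx A -> measurable ((act l \o X) @^-1` A).
Proof.
by move=> bA; exact: (mX (borel_preimage (@act_continuous l) bA)).
Qed.

Definition probR (A : set T) : R := fine (P A).

Lemma probRE A : measurable A -> P A = (probR A)%:E.
Proof. by move=> mA; rewrite fineK // fin_num_measure. Qed.

Hypothesis freeX : forall f : {ffun 'I_d -> 'I_n.+1}, injective f ->
  {ae P, forall w, row_free (walk_frame f (X w))}.
Hypothesis free_flipX : forall f : {ffun 'I_d -> 'I_n.+1}, injective f ->
  {ae P, forall w, row_free (walk_frame f (flip_mx (X w)))}.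

(** Singularity of a frame is a Borel event, so [law_act] carries it to the walk or its flip, where
    independence is assumed. *)
Lemma ae_free_act l (f : {ffun 'I_d -> 'I_n.+1}) : l \in signed_orders n.+1 ->
  injective f -> {ae P, forall w, row_free (walk_frame f (act l (X w)))}.
Proof.
move=> hl finj; pose B := ~` [set M | row_free (walk_frame f M)].
have bB : borel_mx B.
  apply: borelC; apply: borel_open.
  apply: (@open_comp _ _ (walk_frame f) [set N : 'M[R]_d | row_free N]).
    by move=> M _; exact: walk_frame_continuous.
  exact: open_row_free.
suff : P ((act l \o X) @^-1` B) = 0%E.
  by move=> /negligibleP; apply; exact: measurable_act.
rewrite law_act // /even_representative.
case: ifP => _; apply: measure_negligible.
- exact: measurable_flip.
- exact: free_flipX.
- exact: mX.
- exact: freeX.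
Qed.

Lemma ae_generic : (d <= n.+1)%N ->
  {ae P, forall w, generic n.+1 (mx_steps (X w)) (0 : 'M[R]_d) d}.
Proof.
move=> dn.
have : {ae P, forall w, forall l, l \in signed_orders n.+1 ->
    forall f : {ffun 'I_d -> 'I_n.+1}, injective f ->
    row_free (walk_frame f (act l (X w)))}.
  apply: ae_seq => l hl; apply: filter_forall => f.
  case: (pselect (injective f)) => finj; last by apply: aeW.
  by apply: filterS (ae_free_act hl finj) => w.
apply: filterS => w h; apply: generic_of_free => // l hl f finj.
by rewrite -walk_frame_act; exact: h.
Qed.

Lemma encloses_act l M : l \in signed_orders n.+1 ->
  encloses n.+1 (mx_steps (act l M)) <-> hit n.+1 (mx_steps M) (0 : 'M[R]_d) l.
Proof.
move=> hl; rewrite hit_encloses //.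
by split; apply: encloses_eq => k kn; rewrite mx_steps_act.
Qed.

(* The sign of the last step is free for the shorter walk; choose it so that
   the number of sign changes is even. *)
Definition close_order l := rcons l (n, parity l).

Lemma close_order_mem l :
  l \in signed_orders n -> close_order l \in signed_orders n.+1.
Proof.
move=> hl; apply: mem_signed_orders; rewrite map_rcons -cats1.
by rewrite -[in iota _ _]addn1 iotaD perm_cat2r perm_signed_orders.
Qed.

Lemma parity_close_order l : parity (close_order l) = false.
Proof.
rewrite /close_order {1}/parity -cats1 count_cat oddD /= addn0 oddb.
by rewrite -/(parity l) addbb.
Qed.

Lemma encloses_close_order l M : l \in signed_orders n ->
  encloses n (mx_steps (act (close_order l) M)) <->
  hit n (mx_steps M) (0 : 'M[R]_d) l.
Proof.
move=> hl; rewrite hit_encloses //.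
have e k : (k < n)%N ->
    mx_steps (act (close_order l) M) k = walk_steps (mx_steps M) l k.
  move=> kn; rewrite mx_steps_act ?(ltn_trans kn) //.
  by rewrite /walk_steps nth_rcons (size_signed_order hl) kn.
by split; apply: encloses_eq => k kn; rewrite e.
Qed.

(** Even orders carry the law of [X], odd ones that of its flip, and both classes have the same
    size. The probabilities over all orders add up to the almost surely constant chamber count. *)
Lemma probability_encloses : (d <= n.+1)%N ->
  (probR (X @^-1` enclosing n.+1) +
   probR ((flip_mx \o X) @^-1` enclosing n.+1)) *
  (2 ^ n * n.+1`!)%:R = (2 * alt_tail n.+2 (Bpoly n.+1) d)%:~R.
Proof.
move=> dn; have bh := borel_enclosing (ltn0Sn n) (leqnn _).
have count_odd : count parity (signed_orders n.+1) = (2 ^ n * n.+1`!)%N.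
  by rewrite -(count_parity n true); apply: eq_count => l; case: (parity l).
have count_even :
    count (fun l => ~~ parity l) (signed_orders n.+1) = (2 ^ n * n.+1`!)%N.
  by rewrite -(count_parity n false); apply: eq_count => l; case: (parity l).
have := @sum_probability_const _ _ _ P _ (signed_orders n.+1)
  (fun l => (act l \o X) @^-1` enclosing n.+1)
  (2 * alt_tail n.+2 (Bpoly n.+1) d)%:~R (fun l => measurable_act l bh) _.
rewrite big_seq (eq_bigr (fun l => (if parity l then
    probR ((flip_mx \o X) @^-1` enclosing n.+1)
  else probR (X @^-1` enclosing n.+1))%:E)).
  move=> h; apply/EFin_inj; rewrite -h.
    rewrite -big_seq sumEFin; congr (_%:E).
    rewrite (bigID parity) /=.
    rewrite (eq_bigr (fun=> probR ((flip_mx \o X) @^-1` enclosing n.+1))).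
      rewrite [X in _ = _ + X](eq_bigr (fun=> probR (X @^-1` enclosing n.+1))).
        rewrite !big_const_seq !iter_addr_0.
        by rewrite count_odd count_even -mulrnDl mulr_natr addrC.
      by move=> l /negbTE ->.
    by move=> l ->.
  apply: filterS (ae_generic dn) => w gw.
  have := hits_Bpoly gw; rewrite mxrank0 add0n => /(_ erefl) <-.
  rewrite [RHS]rmorph_nat; congr (_%:R); rewrite /hits !big_seq.
  apply: eq_bigr => l hl; congr nat_of_bool; apply: asbool_equiv_eq.
  exact: encloses_act.
move=> l hl; rewrite law_act // /even_representative.
by case: ifP => _; apply: probRE; [exact: measurable_flip|exact: mX].
Qed.

(** Each signed order of the first [n] steps extends to an even one, so only the law of [X] occurs
    in the average. *)
Lemma probability_encloses_prefix : (0 < n)%N -> (d <= n.+1)%N ->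
  probR (X @^-1` enclosing n) * (2 ^ n * n`!)%:R =
  (2 * alt_tail n.+1 (Bpoly n) d)%:~R.
Proof.
move=> n0 dn; have bh := borel_enclosing n0 (leqnSn n).
have := @sum_probability_const _ _ _ P _ (signed_orders n)
  (fun l => (act (close_order l) \o X) @^-1` enclosing n)
  (2 * alt_tail n.+1 (Bpoly n) d)%:~R (fun l => measurable_act _ bh) _.
rewrite big_seq (eq_bigr (fun=> (probR (X @^-1` enclosing n))%:E)).
  move=> h; apply/EFin_inj; rewrite -h.
    rewrite -big_seq sumEFin; congr (_%:E).
    by rewrite big_const_seq iter_addr_0 count_predT size_signed_orders mulr_natr.
  apply: filterS (ae_generic dn) => w /generic_restrict gw.
  have := gw; rewrite -[in generic _](prednK n0) => /hits_Bpoly.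
  rewrite mxrank0 add0n prednK // => /(_ erefl) <-.
  rewrite [RHS]rmorph_nat; congr (_%:R); rewrite /hits !big_seq.
  apply: eq_bigr => l hl; congr nat_of_bool; apply: asbool_equiv_eq.
  exact: encloses_close_order.
move=> l hl; rewrite law_act //; last exact: close_order_mem.
by rewrite /even_representative parity_close_order; apply: probRE; exact: mX.
Qed.

Lemma probability_two_sided : (0 < n)%N -> (d <= n.+1)%N ->
  P (X @^-1` enclosing n.+1 `|` (flip_mx \o X) @^-1` enclosing n.+1) =
  ((2 / (2 ^+ n * (n.+1)`!%:R)) *
   (\sum_(k < n.+2 | (d < k)%N && odd (k - d)) D n.+1 k)%:~R)%:E.
Proof.
move=> n0 dn; have bh := borel_enclosing (ltn0Sn n) (leqnn _).
have bh0 := borel_enclosing n0 (leqnSn n).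
have mh := mX bh; have mfh := measurable_flip bh.
rewrite measureUfinr //; last first.
  by rewrite ltey_eq fin_num_measure.
(* By [encloses_flip], both events occur together exactly when the common first [n] steps
   enclose. *)
have -> : X @^-1` enclosing n.+1 `&` (flip_mx \o X) @^-1` enclosing n.+1 =
    X @^-1` enclosing n.
  apply/seteqP; split=> w /=; rewrite /enclosing /=.
    move=> [h1 h2]; apply/(encloses_flip _ n0); split=> //.
    by apply: encloses_eq h2 => k kn; rewrite mx_steps_flip.
  move=> /(encloses_flip _ n0)[h1 h2]; split=> //.
  by apply: encloses_eq h2 => k kn; rewrite mx_steps_flip.
transitivity (probR (X @^-1` enclosing n.+1) +
    probR ((flip_mx \o X) @^-1` enclosing n.+1) - probR (X @^-1` enclosing n))%:E.
  by rewrite EFinB EFinD; congr (_ + _ - _)%E; apply: probRE => //; exact: mX.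
congr (_%:E); rewrite alt_tail_D.
have := probability_encloses dn; have := probability_encloses_prefix n0 dn.
set p0 := probR _; set p1 := probR _; set p2 := probR _.
rewrite factS !rmorphB !rmorphM /= !rmorph_nat !natrM !natrX.
set t1 := (alt_tail n.+2 _ d)%:~R; set t0 := (alt_tail n.+1 _ d)%:~R.
have n1 : (n.+1%:R : R) != 0 by rewrite pnatr_eq0.
have f0 : (n`!%:R : R) != 0 by rewrite pnatr_eq0 -lt0n fact_gt0.
have two : (2%:R ^+ n : R) != 0 by rewrite expf_neq0 // pnatr_eq0.
move: (n.+1%:R : R) (n`!%:R : R) (2 ^+ n : R) n1 f0 two => N F W n1 f0 two.
(* Over the common denominator the prefix term gains the factor [N], standing for [n.+1], as in
   [alt_tail_D]. *)
move=> e0 e1; have -> : p1 + p2 - p0 =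
    ((p1 + p2) * (W * (N * F)) - N * (p0 * (W * F))) / (W * (N * F)).
  by field; rewrite n1 f0 two.
by rewrite e0 e1; field; rewrite n1 f0 two.
Qed.

End RandomWalk.

(** * Passage from the random steps to a random matrix *)

Unset Implicit Arguments. Set Strict Implicit.

Theorem theorem2p7 (R : realType) (dT : measure_display) (T : measurableType dT)
  (P : probability T R) (d n : nat) (xi : 'I_n -> T -> 'rV[R]_d) :
  (1 <= d)%N -> (2 <= n)%N -> (d <= n)%N ->
  (forall i, random_vector (xi i)) ->
  (forall (s : 'S_n) (eps : 'I_n -> R),
      (forall i, eps i = 1 \/ eps i = -1) -> \prod_i eps i = 1 ->
      eq_in_law P (fun w => \matrix_(i < n, j < d) xi i w 0 j)
                  (fun w => \matrix_(i < n, j < d) (eps i * xi (s i) w 0 j))) ->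
  (forall f : 'I_d -> 'I_n, injective f ->
      {ae P, forall w, lin_indep (fun j => Ssum (fun i => xi i w) (f j))}) ->
  (forall f : 'I_d -> 'I_n, injective f ->
      {ae P, forall w, lin_indep (fun j => Ssum' (fun i => xi i w) (f j))}) ->
  P [set w | conv_hull (Spts (fun i => xi i w)) 0] =
  ((2 / (2 ^+ n.-1 * (n`!)%:R)) *
     (\sum_(k < n.+1 | (d < k)%N && odd (k - d)) D n k)%:~R)%:E.

Proof.
case: n xi => [//|n'] xi d1 n2 dn rv inv free free'.
pose X w : 'M[R]_(n'.+1, d) := \matrix_(i, j) xi i w 0 j.
have stepX w (i : 'I_n'.+1) : mx_steps (X w) i = xi i w.
  by apply/rowP => j; rewrite !mxE inord_val.
(* Measurability is given for each step separately; joint measurability is obtained through the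
   entries. *)
have mX : forall A, borel_mx A -> measurable (X @^-1` A).
  apply: mx_measurable => i j q r.
  rewrite (_ : mkset _ = xi i @^-1` [set v : 'rV[R]_d | `|q - v 0 j| < r]).
    apply: rv; apply: borel_open.
    apply: (@open_comp _ _ (fun v : 'rV[R]_d => v 0 j) [set x | `|q - x| < r]).
      by move=> v _; exact: coord_continuous.
    rewrite (_ : mkset _ = [set x | q - r < x] `&` [set x | x < q + r]).
      by apply: openI; [exact: open_gt|exact: open_lt].
    apply/seteqP; split=> x /=.
      by rewrite ltr_norml => /andP[? ?]; split; lra.
    by move=> [? ?]; rewrite ltr_norml; apply/andP; split; lra.
  by apply/seteqP; split=> w /=; rewrite mxE.
have invX (s : 'S_n'.+1) (eps : 'I_n'.+1 -> R) :
    (forall i, eps i = 1 \/ eps i = -1) -> \prod_i eps i = 1 ->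
    eq_in_law P X (fun w => \matrix_(i, j) (eps i * X w (s i) j)).
  move=> e1 e2; have := inv s eps e1 e2; congr (eq_in_law P _ _).
  by apply/funext => w; apply/matrixP => i j; rewrite !mxE.
have freeX (f : {ffun 'I_d -> 'I_n'.+1}) : injective f ->
    {ae P, forall w, row_free (walk_frame f (X w))}.
  move=> finj; apply: filterS (free f finj) => w; rewrite /lin_indep.
  congr (is_true (row_free _)); apply/row_matrixP => j; rewrite !rowK.
  exact: Ssum_sum (stepX w) _.
have free_flipX (f : {ffun 'I_d -> 'I_n'.+1}) : injective f ->
    {ae P, forall w, row_free (walk_frame f (flip_mx (X w)))}.
  move=> finj; apply: filterS (free' f finj) => w; rewrite /lin_indep.
  congr (is_true (row_free _)); apply/row_matrixP => j; rewrite !rowK.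
  rewrite (Ssum'_sum (stepX w)); apply: eq_bigr => i _.
  by rewrite mx_steps_flip // (leq_trans (ltn_ord i)).
have <- := probability_two_sided mX invX freeX free_flipX n2 dn.
congr (P _); apply/seteqP; split=> w /=.
  move=> /(conv_hull_encloses (stepX w) n2) [h|h]; [by left|right].
  by apply: encloses_eq h => k kn; rewrite mx_steps_flip.
move=> h; apply/(conv_hull_encloses (stepX w) n2).
case: h => h; [by left|right].
by apply: encloses_eq h => k kn; rewrite mx_steps_flip.
Qed.
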